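(* Let $T$ be an EMR map of $I=[0,1]$, and let $\mu$ be an infinite entropy Gibbs measure for $T$ associated to a potential $\log\varphi$ such that $\operatorname{var}_1(\log\varphi)<\infty$ and such that there are constants $0<K\le K'<\infty$ with $K\le \varphi(x_{n+1})/\varphi(x_n)\le K'$ for all $n\in\mathbb N$. If the decay ratio $$s=\lim_{n\to\infty}\frac{\log p_n}{\log r_n}$$ exists, then for $\mu$-almost every $x$, $$\underline\delta(x)=\liminf_{n\to\infty}\frac{\log\mu(I_n(x))}{\log|I_n(x)|}=\limsup_{n\to\infty}\frac{\log\mu(I_n(x))}{\log|I_n(x)|}=\overline\delta(x)=s .$$
   Context: EMR maps. A map $T\colon I\to I$, $I=[0,1]$, is an EMR (Expanding-Markov-Renyi) map if there is a countable collection of closed intervals $\{I(n)\}_{n\in\mathbb N}$ with disjoint interiors such that: (1) $T$ is $C^2$ on $\bigcup_n\operatorname{int} I(n)$; (2) there are a positive integer $r$ and $\alpha_0>1$ with $|(T^r)'(x)|\ge\alpha_0$ at all points $x\in\bigcup_n\operatorname{int}I(n)$ where it is defined; (3) $T$ is Markov and coded by the full shift on $\mathbb N$, i.e. each restriction $T|_{\operatorname{int}I(n)}$ extends to a homeomorphism of $I(n)$ onto $[0,1]$; (4) (Renyi's condition) there is $E>0$ with $\sup_n\sup_{x,y,z\in \operatorname{int}I(n)}\frac{|T''(x)|}{|T'(y)||T'(z)|}\le E$. Standing conventions: the branches are orientation preserving, the intervals accumulate only at the left endpoint $0$, and are indexed so that $I(n+1)$ lies to the left of $I(n)$. Put $r_n=|I(n)|$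 (length). Coding. For $(a_1,\dots,a_n)\in\mathbb N^n$, $I(a_1,\dots,a_n)=I(a_1)\cap T^{-1}(I(a_2))\cap\dots\cap T^{-(n-1)}(I(a_n))$, each $T|_{I(k)}$ being understood as the homeomorphism $I(k)\to[0,1]$. Let $\Sigma=\mathbb N^{\mathbb N}$ with the shift $\sigma$ and cylinders $C(a_1,\dots,a_n)$, and let $\pi\colon\Sigma\to I$ send $(a_k)$ to the unique point of $\bigcap_nI(a_1,\dots,a_n)$. Outside a countable set of points, each $x$ has a unique coding $(a_k)$, and $I_n(x)=I(a_1,\dots,a_n)$; $|\cdot|$ is length. Measures and functions on $\Sigma$ and on $I$ are identified via $\pi$. Gibbs measures. A $\sigma$-invariant Borel probability measure $\mu$ on $\Sigma$ is a Gibbs measure associated to the potential $\log\varphi\colon\Sigma\to\mathbb R$ if there are constants $A,B>0$ and a constant $P(\log\varphi)$ (the topological pressure) with $$A\le\frac{\mu(C(a_1,\dots,a_n))}{\exp(-nP(\log\varphi)+S_n(\log\varphi)(x))}\le B$$ for all $n$, all $(a_1,\dots,a_n)$ and all $x\in C(a_1,\dots,a_n)$, where $S_nf=\sum_{k=0}^{n-1}f\circ\sigma^k$. Standing assumptions: $P(\log\varphi)=0$ and $\mu$ is ergodic; $\mu$ also denotes the projected $T$-invariant measure on $I$. ''Infinite entropy'' means the metric entropy $h_\mu$ of $(T,\mu)$ is $\infty$. Notation. $p_n=\mu(I(n))$; $x_n$ is the fixed point of $T$ in $I(n)$ (coded by $(n,n,n,\dots)$); $\operatorname{var}_1(\log\varphi)=\sup\{|\log\varphi(x)-\log\varphi(y)|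 : x,y\in I(a),\ a\in\mathbb N\}$. The decay ratio can equivalently be written $\lim_n\log\varphi(x_n)/\log r_n$. *)

(* Defs.v *)
From HB Require Import structures.
From mathcomp Require Import all_boot all_order all_algebra.
From mathcomp Require Import all_classical all_reals all_analysis.

Set Implicit Arguments.
Unset Strict Implicit.
Unset Printing Implicit Defensive.

Import Order.TTheory GRing.Theory Num.Theory.
Import numFieldNormedType.Exports.

Local Open Scope classical_set_scope.
Local Open Scope ring_scope.

Section dynamics.
Context {d : measure_display} {X : measurableType d} {R : realType}.
Variables (m : set X -> \bar R) (f : X -> X).

Definition invariant_measure : Prop :=
  forall A : set X, measurable A -> m (f @^-1` A) = m A.

Definition ergodic : Prop :=
  forall A : set X, measurable A -> f @^-1` A = A -> m A = 0%E \/ m A = 1%E.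

Definition finite_measurable_partition (k : nat) (P : 'I_k -> set X) : Prop :=
  [/\ forall i, measurable (P i),
      trivIset setT P &
      \bigcup_(i in [set: 'I_k]) P i = setT].

(* The atom of the join of P, f^-1 P, ..., f^-(n-1) P with itinerary w. *)
Definition join_atom (k : nat) (P : 'I_k -> set X) (n : nat)
    (w : {ffun 'I_n -> 'I_k}) : set X :=
  [set x | forall i : 'I_n, P (w i) (iter i f x)].

(* As ln 0 = 0, null atoms contribute 0. *)
Definition join_entropy (k : nat) (P : 'I_k -> set X) (n : nat) : R :=
  \sum_(w : {ffun 'I_n -> 'I_k})
    - (fine (m (join_atom P w)) * ln (fine (m (join_atom P w)))).

Definition partition_entropy (k : nat) (P : 'I_k -> set X) : \bar R :=
  limn (fun n : nat => (join_entropy P n.+1 / n.+1%:R)%:E).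

(* Kolmogorov-Sinai entropy of (f, m). *)
Definition metric_entropy : \bar R :=
  ereal_sup [set h | exists (k : nat) (P : 'I_k -> set X),
    finite_measurable_partition P /\ h = partition_entropy P].

End dynamics.

(* N^N with the Borel sigma-algebra of the product of the discrete
   topologies. *)
Notation Sigma := (g_sigma_algebraType (@open {ptws nat -> nat})).

Definition sshift (a : Sigma) : Sigma := fun k => a k.+1.

Definition Scyl (w : seq nat) : set Sigma :=
  [set a : Sigma | mkseq a (size w) = w].

Section gibbs.
Context {R : realType}.

Definition birkhoff_sum (g : Sigma -> R) (n : nat) (a : Sigma) : R :=
  \sum_(k < n) g (iter k sshift a).

Definition gibbs_measure (mu : set Sigma -> \bar R) (g : Sigma -> R) (P : R) :
    Prop :=
  invariant_measure mu sshift /\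
  exists A B : R, [/\ 0 < A, 0 < B &
    forall (w : seq nat) (a : Sigma), Scyl w a ->
      A <= fine (mu (Scyl w)) /
           expR (- ((size w)%:R * P) + birkhoff_sum g (size w) a) <= B].

Definition var1 (g : Sigma -> R) : \bar R :=
  ereal_sup [set v | exists (n : nat) (a b : Sigma),
    [/\ Scyl [:: n] a, Scyl [:: n] b & v = `|g a - g b|%:E]].

End gibbs.

Section emr.
Context {R : realType}.

Definition homeomorphic_on (A B : set R) (f : R -> R) : Prop :=
  exists g : R -> R,
    [/\ set_fun A B f, set_fun B A g,
        (forall x, A x -> g (f x) = x), (forall y, B y -> f (g y) = y) &
        {within A, continuous f} /\ {within B, continuous g}].

(* I(n) = [emr_l n, emr_u n]. The map emr_branch n is the extension of the
   restriction of T to int I(n) to I(n); only its values on I(n) matter, and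
   there it is determined by T. *)
Record EMR_map : Type := MkEMR {
  emr_T : R -> R;
  emr_l : nat -> R;
  emr_u : nat -> R;
  emr_branch : nat -> R -> R;
  emr_self : set_fun `[0, 1] `[0, 1] emr_T;
  (* Automatic if the I(n) cover [0, 1] up to a countable set; needed for T to
     be a Borel map when there are gaps between them. *)
  emr_meas : measurable_fun (`[0, 1] : set R) emr_T;
  emr_nondeg : forall n, emr_l n < emr_u n;
  emr_sub : forall n, `[emr_l n, emr_u n] `<=` (`[0, 1] : set R);
  emr_disj : trivIset setT (fun n => `]emr_l n, emr_u n[%classic);
  emr_left : forall n, emr_u n.+1 <= emr_l n;
  emr_acc : emr_l @ \oo --> (0 : R);
  emr_C2 : forall n x, x \in `]emr_l n, emr_u n[ ->
    [/\ derivable emr_T x 1, derivable (derive1 emr_T) x 1 &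
        {for x, continuous (derive1n 2 emr_T)}];
  emr_expanding : exists (r : nat) (alpha0 : R), [/\ (0 < r)%N, 1 < alpha0 &
    forall n x, x \in `]emr_l n, emr_u n[ ->
      derivable (iter r emr_T) x 1 ->
      alpha0 <= `|derive1 (iter r emr_T) x|];
  emr_branch_homeo : forall n,
    homeomorphic_on `[emr_l n, emr_u n] `[0, 1] (emr_branch n);
  emr_branchE : forall n x, x \in `]emr_l n, emr_u n[ ->
    emr_branch n x = emr_T x;
  emr_branch_incr : forall n,
    {in `[emr_l n, emr_u n] &, {homo emr_branch n : x y / x < y}};
  (* The quotient in Renyi's condition presupposes T' != 0, while x / 0 = 0
     in MathComp. *)
  emr_deriv_neq0 : forall n x, x \in `]emr_l n, emr_u n[ ->
    derive1 emr_T x != 0;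
  emr_renyi : exists E : R, 0 < E /\ forall n x y z,
    x \in `]emr_l n, emr_u n[ -> y \in `]emr_l n, emr_u n[ ->
    z \in `]emr_l n, emr_u n[ ->
    `|derive1n 2 emr_T x| / (`|derive1 emr_T y| * `|derive1 emr_T z|) <= E
}.

Definition len (A : set R) : R := fine (lebesgue_measure A).

Variable T : EMR_map.

Definition emr_I (n : nat) : set R := `[emr_l T n, emr_u T n].

Fixpoint emr_cyl (w : seq nat) : set R :=
  if w is a :: w' then emr_I a `&` emr_branch T a @^-1` emr_cyl w'
  else `[0, 1].

(* The intersection is a singleton for an EMR map; the default is not used. *)
Definition emr_pi (a : Sigma) : R :=
  xget 0 (\bigcap_n emr_cyl (mkseq a n)).

(* The coding of x. Points with no coding, or with two, form a null set for
   every projection of a nonatomic measure; their value is irrelevant. *)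
Definition emr_coding (x : R) : Sigma :=
  xget (fun _ => 0%N) [set a : Sigma | emr_pi a = x].

Definition emr_In (n : nat) (x : R) : set R := emr_cyl (mkseq (emr_coding x) n).

Variable mu : set Sigma -> \bar R.

Definition emr_proj : set R -> \bar R := pushforward mu emr_pi.

Definition emr_p (n : nat) : R := fine (emr_proj (emr_I n)).

Definition emr_r (n : nat) : R := len (emr_I n).

Definition delta_seq (x : R) (n : nat) : \bar R :=
  (ln (fine (emr_proj (emr_In n x))) / ln (len (emr_In n x)))%:E.

Definition delta_lower (x : R) : \bar R := limn_einf (delta_seq x).

Definition delta_upper (x : R) : \bar R := limn_esup (delta_seq x).

End emr.
Arguments EMR_map : clear implicits.

(* Main.v *)
Require Import Defs.
From HB Require Import structures.
From mathcomp Require Import all_boot all_order all_algebra.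
From mathcomp Require Import all_classical all_reals all_analysis.
From mathcomp Require Import measurable_realfun ring lra.

(** The Gibbs property makes [mu] quasi-multiplicative on cylinders and Renyi's
condition does the same for lengths: writing [a] for the coding of [x],
[ln mu(I_n(x))] and [ln |I_n(x)|] are within [O(n)] of
[\sum_(k < n) ln p_(a k)] and [\sum_(k < n) ln r_(a k)]. Since
[ln p_n / ln r_n] tends to [s], the two sums satisfy
[|\sum ln p - s \sum ln r| <= eps * \sum (- ln r) + O(n)], so the ratio tends to
[s] as soon as [\sum_(k < n) - ln r_(a k)] grows faster than linearly.

That growth holds almost everywhere when [- ln r_(a 0)] has infinite integral:
otherwise ergodicity would make the growth at most linear almost everywhere, and
the maximal ergodic inequality would bound the integral. The integral is infinite
because if [- ln p_(a 0)] were integrable, all entropies of finite partitions would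
have a common bound. To see this, a finite partition [q] is approximated by one,
[q'], depending on finitely many symbols; sending the [q']-itinerary through a noisy
channel gives a law on [q]-itineraries, and Gibbs' inequality bounds the entropy of
[q]-itineraries by their cross entropy relative to that law, which is the entropy of
the symbols plus a bounded amount per step. *)

Import Order.TTheory GRing.Theory Num.Theory.
Import numFieldNormedType.Exports.

Local Open Scope classical_set_scope.
Local Open Scope ring_scope.

Set Implicit Arguments.
Unset Strict Implicit.
Unset Printing Implicit Defensive.

(** * The full shift *)

Lemma Scyl_mkseqE (a : Sigma) n b :
  Scyl (mkseq a n) b <-> forall i, (i < n)%N -> b i = a i.
Proof.
rewrite /Scyl /= size_mkseq; split=> [E i lin|E].
  by rewrite -(nth_mkseq 0%N b lin) E nth_mkseq.
apply: (@eq_from_nth _ 0%N); rewrite ?size_mkseq// => i lin.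
by rewrite !nth_mkseq// E.
Qed.

Lemma Scyl_mkseq (a : Sigma) n : Scyl (mkseq a n) a.
Proof. exact/Scyl_mkseqE. Qed.

Lemma ScylE w (a : Sigma) : Scyl w a -> w = mkseq a (size w).
Proof. by []. Qed.

Lemma Scyl_open w : open (Scyl w : set {ptws nat -> nat}).
Proof.
have -> : Scyl w = [set a : Sigma | forall i, (i < size w)%N -> a i = nth 0%N w i].
  apply/seteqP; split=> a /=.
    by move=> /ScylE E i iw; rewrite [in RHS]E nth_mkseq.
  move=> E; rewrite /Scyl/=; apply: (@eq_from_nth _ 0%N); rewrite ?size_mkseq//.
  by move=> i iw; rewrite nth_mkseq// E.
elim: (size w) => [|n IH].
  have -> : [set a : Sigma | forall i, (i < 0)%N -> a i = nth 0%N w i] = setT.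
    by apply/seteqP; split.
  exact: openT.
have -> : [set a : Sigma | forall i, (i < n.+1)%N -> a i = nth 0%N w i] =
  [set a : Sigma | forall i, (i < n)%N -> a i = nth 0%N w i] `&`
  (fun a : {ptws nat -> nat} => a n) @^-1` [set nth 0%N w n].
  apply/seteqP; split=> a /=.
    by move=> E; split=> [i lin|]; apply: E => //; exact: ltnW.
  by move=> [E En] i; rewrite ltnS leq_eqVlt => /orP[/eqP ->//|]; exact: E.
apply: openI => //; apply: open_comp; last exact: discrete_open.
move=> a _; exact: (@proj_continuous nat (fun _ => nat : topologicalType) n a).
Qed.

Lemma measurable_Scyl w : measurable (Scyl w : set Sigma).
Proof. apply: sub_sigma_algebra; exact: Scyl_open. Qed.

Definition cyl_open (U : set Sigma) :=
  forall a, U a -> exists n, Scyl (mkseq a n) `<=` U.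

(** Otherwise every cylinder around [a] contains a point outside [U]; these points converge to [a]
    coordinatewise, although [U] is a neighbourhood of [a]. *)
Lemma open_cyl_open (U : set {ptws nat -> nat}) : open U -> cyl_open U.
Proof.
move=> oU a Ua; apply: contrapT => /forallNP H.
have /choice[b Hb] n : exists b : nat -> nat, Scyl (mkseq a n) b /\ ~ U b.
  by have /existsNP[b /not_implyP[? ?]] := H n; exists b.
have ba : {ptws, b @ \oo --> (a : nat -> nat)}.
  apply/pointwise_cvgP => t; apply: cvg_near_cst.
  exists t.+1 => // n /= tn.
  by have [/Scyl_mkseqE/(_ t tn) ->] := Hb n.
have [N _ HN] := ba U (open_nbhs_nbhs (conj oU Ua)).
by have [_ []] := Hb N; apply: (HN N) => /=.
Qed.

Lemma cyl_open_measurable (U : set Sigma) : cyl_open U -> measurable U.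
Proof.
move=> oU.
have -> : U = \bigcup_(w in [set w : seq nat | Scyl w `<=` U]) Scyl w.
  apply/seteqP; split=> [a Ua|a [w] /=]; last exact.
  by have [n nU] := oU a Ua; exists (mkseq a n) => //; exact: Scyl_mkseq.
rewrite bigcup_mkcond; apply: countable_bigcupT_measurable => // w.
by case: ifP => // _; exact: measurable_Scyl.
Qed.

(** There are only countably many words, so every open set is a countable union of cylinders, and
    the cylinders already generate the Borel sets. *)
Lemma Sigma_measurable_ind (G : set (set Sigma)) :
  sigma_algebra setT G -> (forall w, G (Scyl w)) -> measurable `<=` G.
Proof.
move=> sG Gcyl; apply: smallest_sub => // U oU.
have -> : U = \bigcup_n (if (@unpickle (seq nat) n) is Some w then
    (if `[< Scyl w `<=` U >] then Scyl w else set0) else set0).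
  apply/seteqP; split=> [a Ua|a [n _]].
    have [n nU] := open_cyl_open oU Ua; exists (pickle (mkseq a n)) => //.
    by rewrite pickleK; case: asboolP => // _; exact: Scyl_mkseq.
  by case: unpickle => // w; case: asboolP => // wU; exact: wU.
have [G0 _ GU] := sG; apply: GU => n /=.
by case: asboolP.
Qed.

Lemma sshiftE (a : Sigma) n k : iter n sshift a k = a (n + k)%N.
Proof. by elim: n k => //= n IH k; rewrite /sshift IH addnS. Qed.

Lemma Scyl_shift (a b : Sigma) n k :
  Scyl (mkseq a (k + n)) b -> Scyl (mkseq (iter k sshift a) n) (iter k sshift b).
Proof.
move=> /Scyl_mkseqE H; apply/Scyl_mkseqE => i lin.
by rewrite !sshiftE; apply: H; rewrite ltn_add2l.
Qed.

Lemma cyl_open_shift U k : cyl_open U -> cyl_open (iter k sshift @^-1` U).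
Proof.
move=> oU a /= /oU[n nU]; exists (k + n)%N => b /Scyl_shift; exact: nU.
Qed.

Lemma measurable_sshift : measurable_fun setT sshift.
Proof.
apply: (@measurability _ _ _ _ setT sshift (@open {ptws nat -> nat})) => //.
move=> _ [U oU <-]; rewrite setTI; apply: cyl_open_measurable.
exact: (@cyl_open_shift _ 1%N (open_cyl_open oU)).
Qed.

(** As the alphabet is infinite, such a set may be an infinite union of cylinders of length [m]. *)
Definition determined (m : nat) (B : set Sigma) :=
  forall a b, mkseq a m = mkseq b m -> B a -> B b.

Lemma measurable_determined m B : determined m B -> measurable B.
Proof.
move=> dB; apply: cyl_open_measurable => a Ba; exists m => b.
by rewrite /Scyl/= size_mkseq => E; apply: dB Ba; rewrite E.
Qed.

Lemma determined_widen m n B : (m <= n)%N -> determined m B -> determined n B.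
Proof.
move=> mn dB a b E; apply: dB; apply: (@eq_from_nth _ 0%N).
  by rewrite !size_mkseq.
rewrite size_mkseq => i im; rewrite !nth_mkseq//.
have lin := leq_trans im mn.
by rewrite -(nth_mkseq 0%N a lin) E nth_mkseq.
Qed.

(** * Growth of Birkhoff sums *)

Lemma measurable_ltr d (X : measurableType d) (R : realType) (u v : X -> R) :
  measurable_fun setT u -> measurable_fun setT v ->
  measurable [set x | u x < v x].
Proof.
move=> mu mv; rewrite -[X in measurable X]setTI.
have := measurable_fun_ltr mu mv measurableT (Y := [set true]).
by apply.
Qed.

Section invariant_dynamics.
Context {d : measure_display} {X : measurableType d} {R : realType}.
Variables (m : probability X R) (f : X -> X).
Hypotheses (mf : measurable_fun setT f) (inv_m : invariant_measure m f).

Lemma measurable_iter n : measurable_fun setT (iter n f).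
Proof.
elim: n => [|n IH]; first exact: measurable_id.
exact: (@measurableT_comp _ _ _ _ _ _ f).
Qed.

Lemma invariant_iter n A : measurable A -> m (iter n f @^-1` A) = m A.
Proof.
move=> mA; elim: n => [//|n IH].
rewrite (_ : iter n.+1 f @^-1` A = f @^-1` (iter n f @^-1` A)); last first.
  by apply/seteqP; split=> x /=; rewrite -iterS iterSr.
rewrite inv_m// -[X in measurable X]setTI; exact: measurable_iter.
Qed.

Lemma integral_invariant n (g : X -> \bar R) : measurable_fun setT g ->
  (forall x, (0 <= g x)%E) ->
  (\int[m]_x g (iter n f x) = \int[m]_x g x)%E.
Proof.
move=> mg g0; have := @ge0_integral_pushforward _ _ _ _ _ _ (measurable_iter n) m
  setT g measurableT mg (fun x _ => g0 x).
rewrite preimage_setT => <-.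
apply: eq_measure_integral => [|? A mA _]; first exact: measurable_iter.
exact: invariant_iter.
Qed.

(* The maximum of the first n partial sums of c - g along the orbit of x, and 0. *)
Fixpoint max_sum (c : R) (g : X -> R) (n : nat) (x : X) : R :=
  if n is n'.+1 then Num.max 0 (c - g x + max_sum c g n' (f x)) else 0.

Variables (c : R) (g : X -> R).
Hypotheses (c0 : 0 <= c) (mg : measurable_fun setT g) (g0 : forall x, 0 <= g x).

Lemma max_sum_ge0 n x : 0 <= max_sum c g n x.
Proof. by case: n => //= n; rewrite le_max lexx. Qed.

Lemma measurable_max_sum n : measurable_fun setT (max_sum c g n).
Proof.
elim: n => [|n IH]; first exact: measurable_cst.
apply: measurable_maxr; first exact: measurable_cst.
apply: measurable_funD.
  by apply: measurable_funB => //; exact: measurable_cst.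
exact: measurableT_comp.
Qed.

Lemma max_sum_bound n x : max_sum c g n x <= n%:R * c.
Proof.
elim: n x => [|n IH] x /=; first by rewrite mul0r.
rewrite ge_max mulr_ge0//= -natr1 mulrDl mul1r.
have := IH (f x); have := g0 x; lra.
Qed.

Lemma max_sum_nd n x : max_sum c g n x <= max_sum c g n.+1 x.
Proof.
elim: n x => [|n IH] x; first exact: max_sum_ge0.
by rewrite /= le_max2//; rewrite lerD2l; exact: IH.
Qed.

(** A positive maximum is attained by a nonempty partial sum, so it equals [c - g x] plus the
    maximum over one term fewer started at [f x], and that maximum grows with [n]. *)
Lemma max_sum_step n x : 0 < max_sum c g n x ->
  max_sum c g n x + g x <= max_sum c g n (f x) + c.
Proof.
case: n => [|n]; first by rewrite /= ltxx.
have := max_sum_nd n (f x); move: (max_sum c g n.+1 (f x)) => M nM.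
rewrite /= lt_max ltxx /= => n0; rewrite max_r; [lra|exact: ltW].
Qed.

Lemma max_sum_gt0 n x :
  n%:R * c > \sum_(k < n) g (iter k f x) -> 0 < max_sum c g n x.
Proof.
suff : n%:R * c - \sum_(k < n) g (iter k f x) <= max_sum c g n x by lra.
elim: n x => [|n IH] x; first by rewrite big_ord0 mul0r subrr.
rewrite /= le_max; apply/orP; right.
rewrite big_ord_recl -natr1 mulrDl mul1r.
under eq_bigr do rewrite iterSr.
by have /= := IH (f x); lra.
Qed.

Lemma measurable_max_sum_gt0 n : measurable [set x | 0 < max_sum c g n x].
Proof.
apply: measurable_ltr; first exact: measurable_cst.
exact: measurable_max_sum.
Qed.

(* max_sum n = c - g + max_sum (n - 1) o f where max_sum n > 0: integrating,
   invariance cancels the two maxima. *)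
Lemma maximal_inequality n :
  (\int[m]_(x in [set x | (0 < max_sum c g n x)%R]) (g x)%:E <= c%:E)%E.
Proof.
set E := [set _ | _]; have mE : measurable E := measurable_max_sum_gt0 n.
pose F x := (max_sum c g n x)%:E.
have mF : measurable_fun setT F by exact/measurable_EFinP/measurable_max_sum.
have F0 x : (0 <= F x)%E by rewrite lee_fin max_sum_ge0.
have IF : (\int[m]_x F x)%E \is a fin_num.
  rewrite ge0_fin_numE; last exact: integral_ge0.
  apply: (@le_lt_trans _ _ (\int[m]_x (cst (n%:R * c)%:E) x)%E).
    apply: ge0_le_integral => // x _; rewrite lee_fin; exact: max_sum_bound.
  by rewrite integral_cst//= probability_setT mule1 ltry.
rewrite integral_mkcond -(leeD2lE _ _ IF).
(* Invariance replaces [F] on the right by its composite with [f]; the inequality then holds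
   pointwise, by [max_sum_step] where the maximum is positive and trivially elsewhere. *)
rewrite -[X in (_ <= X + _)%E](integral_invariant 1%N mF F0).
rewrite -[X in (_ <= _ + X)%E]mule1 -(probability_setT m) -integral_cst//.
have mgE : measurable_fun setT ((EFin \o g) \_ E).
  apply/(measurable_restrictT _ mE); apply: measurable_funTS.
  exact/measurable_EFinP.
have g0E x : (0 <= ((EFin \o g) \_ E) x)%E.
  by apply: erestrict_ge0 => y _; rewrite lee_fin.
have mFf : measurable_fun setT (fun x => F (iter 1 f x)).
  exact: (measurableT_comp mF mf).
rewrite -ge0_integralD// -ge0_integralD//.
apply: ge0_le_integral => //.
- by move=> x _; rewrite adde_ge0.
- exact: emeasurable_funD.
- by apply: emeasurable_funD; [|exact: measurable_cst].
move=> x _; rewrite /patch /F /=; case: ifPn => [|/negP].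
  rewrite inE /E /= => Ex; rewrite -EFinD lee_fin.
  exact: max_sum_step.
rewrite inE /E /= => /negP; rewrite -leNgt => Fx.
by rewrite adde0 lee_fin (le_trans Fx)// addr_ge0// max_sum_ge0.
Qed.

Lemma measurable_sum_lt :
  measurable [set x | exists n, \sum_(k < n) g (iter k f x) < n%:R * c].
Proof.
have -> : [set x | exists n, \sum_(k < n) g (iter k f x) < n%:R * c] =
    \bigcup_n [set x | \sum_(k < n) g (iter k f x) < n%:R * c].
  by apply/seteqP; split=> x /= [n]; exists n.
apply: bigcupT_measurable => n; apply: measurable_ltr.
  apply: measurable_sum => k; apply: (measurableT_comp mg).
  exact: measurable_iter.
exact: measurable_cst.
Qed.

(** The sets where [max_sum] is positive increase to a set of full measure, so monotone convergence
    extends the maximal inequality to the whole space. Integrability of [g] comes out as a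
    conclusion. *)
Lemma unbounded_sum_integral :
  m [set x | exists n, \sum_(k < n) g (iter k f x) < n%:R * c] = 1%E ->
  (\int[m]_x (g x)%:E <= c%:E)%E.
Proof.
set B := [set _ | _] => B1.
pose E n := [set x | 0 < max_sum c g n x].
have mE n : measurable (E n) by exact: measurable_max_sum_gt0.
have ndE : nondecreasing_seq E.
  apply/nondecreasing_seqP => n; apply/subsetPset => x; rewrite /E/= => Ex.
  exact: lt_le_trans (max_sum_nd n x).
have mg' : measurable_fun setT (EFin \o g) by exact/measurable_EFinP.
have mUE : measurable (\bigcup_n E n) by exact: bigcupT_measurable.
have mB : measurable B := measurable_sum_lt.
have BE : B `<=` \bigcup_n E n.
  by move=> x [n Hn]; exists n => //; exact: max_sum_gt0.
have UE1 : m (~` \bigcup_n E n) = 0%E.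
  rewrite probability_setC// (_ : m (\bigcup_n E n) = 1%E) ?subee//.
  apply/eqP; rewrite eq_le probability_le1//=.
  by rewrite -B1; apply: le_measure; rewrite ?inE.
rewrite (ge0_negligible_integral (N := ~` \bigcup_n E n)) //; last first.
- by move=> x _; rewrite lee_fin.
- exact: measurableC.
rewrite setTD setCK.
have := @ge0_nondecreasing_set_cvg_integral _ _ _ E (EFin \o g) m ndE mE
  (fun i => measurable_funTS mg') (fun i x _ => g0 x).
move=> /(cvg_lim _) <-//.
apply: lime_le; last by near=> n; exact: maximal_inequality.
apply: ereal_nondecreasing_is_cvgn => i j ij.
apply: ge0_subset_integral => //; first exact: measurable_funTS.
  by move=> x _; rewrite lee_fin.
by apply/subsetPset; exact: ndE.
Unshelve. all: by end_near. Qed.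

(** The arbitrary margin [j] absorbs the effect of adding or dropping one point of the orbit, so the
    set is invariant exactly and not merely up to a null set. *)
Definition slow_growth (c : R) (g : X -> R) : set X :=
  [set x | forall j : nat, exists n : nat,
     \sum_(k < n) g (iter k f x) + j%:R < n%:R * c].

End invariant_dynamics.

Section ergodic_growth.
Context {d : measure_display} {X : measurableType d} {R : realType}.
Variables (m : probability X R) (f : X -> X).
Hypotheses (mf : measurable_fun setT f) (inv_m : invariant_measure m f).
Hypothesis erg_m : ergodic m f.
Variable g : X -> R.
Hypotheses (mg : measurable_fun setT g) (g0 : forall x, 0 <= g x).

Lemma measurable_slow_growth c : measurable (slow_growth f c g).
Proof.
have -> : slow_growth f c g = \bigcap_j \bigcup_n
    [set x | \sum_(k < n) g (iter k f x) + j%:R < n%:R * c].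
  apply/seteqP; split=> x /= H j; first by move=> _; have [n] := H j; exists n.
  by have [n _] := H j I; exists n.
apply: bigcapT_measurable => j; apply: bigcupT_measurable => n.
apply: measurable_ltr; last exact: measurable_cst.
apply: measurable_funD; last exact: measurable_cst.
by apply: measurable_sum => k; apply: (measurableT_comp mg); exact: measurable_iter.
Qed.

Lemma slow_growth_invariant c : 0 <= c ->
  f @^-1` slow_growth f c g = slow_growth f c g.
Proof.
move=> c0; have sumS n x : \sum_(k < n.+1) g (iter k f x) =
    g x + \sum_(k < n) g (iter k f (f x)).
  by rewrite big_ord_recl; congr (_ + _); apply: eq_bigr => k _; rewrite iterSr.
apply/seteqP; split=> x /= H j.
  (* Prepending [x] to the orbit adds [g x] to the sum, which the larger margin compensates. *)
  have [n Hn] := H (j + (Num.bound (g x)))%N; exists n.+1.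
  rewrite sumS -natr1; have := archi_boundP (g0 x); move: Hn; rewrite natrD; lra.
(* Dropping [x] lowers the right-hand side by [c], which the margin pays for; [n = 0] cannot occur,
   as the right-hand side would be 0. *)
have [[|n] Hn] := H (j + (Num.bound c))%N.
  by move: Hn; rewrite big_ord0 mul0r add0r ltNge ler0n.
exists n; have := archi_boundP c0; move: Hn; rewrite sumS natrD -natr1.
have := g0 x; lra.
Qed.

(** By ergodicity the measure is 0 or 1, and 1 would bound the integral of [g] by [c]. *)
Lemma slow_growth_null c : 0 <= c -> (\int[m]_x (g x)%:E = +oo)%E ->
  m (slow_growth f c g) = 0%E.
Proof.
move=> c0 goo; have mB := measurable_slow_growth c.
have [//|B1] := erg_m mB (slow_growth_invariant c0).
suff : (\int[m]_x (g x)%:E <= c%:E)%E by rewrite goo leye_eq.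
apply: (unbounded_sum_integral mf inv_m) => //.
have mS := measurable_sum_lt mf c mg.
apply/eqP; rewrite eq_le probability_le1//=.
rewrite -B1; apply: le_measure; rewrite ?inE//.
by move=> x /(_ 0%N)[n]; rewrite addr0; exists n.
Qed.

End ergodic_growth.

(** * Cylinders and distortion of an EMR map *)

Section emr_intervals.
Context {R : realType}.
Variable T : EMR_map R.
Local Notation l := (emr_l T).
Local Notation u := (emr_u T).
Local Notation br := (emr_branch T).

Definition emr_inv (n : nat) : R -> R := projT1 (cid (emr_branch_homeo T n)).

Lemma emr_inv_in n y : y \in `[0, 1] -> emr_inv n y \in `[l n, u n].
Proof. by rewrite /emr_inv; case: cid => g [_ + _ _ _] /= => /(_ y). Qed.

Lemma emr_branch_in n x : x \in `[l n, u n] -> br n x \in `[0, 1].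
Proof. by have [g [+ _ _ _ _]] := emr_branch_homeo T n => /(_ x). Qed.

Lemma emr_branchK n x : x \in `[l n, u n] -> emr_inv n (br n x) = x.
Proof. by rewrite /emr_inv; case: cid => g [_ _ + _ _] /= => /(_ x). Qed.

Lemma emr_invK n y : y \in `[0, 1] -> br n (emr_inv n y) = y.
Proof. by rewrite /emr_inv; case: cid => g [_ _ _ + _] /= => /(_ y). Qed.

Lemma emr_branch_continuous n : {within `[l n, u n], continuous br n}.
Proof. by have [g [_ _ _ _ []]] := emr_branch_homeo T n. Qed.

Lemma emr_branch_le n : {in `[l n, u n] &, {mono br n : x y / x <= y}}.
Proof. exact/le_mono_in/emr_branch_incr. Qed.

Lemma emr_branch_lt n : {in `[l n, u n] &, {mono br n : x y / x < y}}.
Proof. exact/leW_mono_in/emr_branch_le. Qed.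

Lemma emr_l_ge0 n : 0 <= l n.
Proof.
have /(_ (l n)) := @emr_sub _ T n; rewrite /= !in_itv /= lexx ltW ?emr_nondeg//.
by move=> /(_ isT)/andP[].
Qed.

Lemma emr_u_le1 n : u n <= 1.
Proof.
have /(_ (u n)) := @emr_sub _ T n; rewrite /= !in_itv /= lexx ltW ?emr_nondeg//.
by move=> /(_ isT)/andP[].
Qed.

Lemma emr_l_gt0 n : 0 < l n.
Proof.
apply: lt_le_trans (emr_left T n).
exact: le_lt_trans (emr_l_ge0 n.+1) (emr_nondeg T _).
Qed.

Lemma emr_u_le_l m n : (m < n)%N -> u n <= l m.
Proof.
elim: n => // n IH; rewrite ltnS leq_eqVlt => /orP[/eqP ->|/IH nm].
  exact: emr_left.
by apply: le_trans (emr_left T _) _; apply: le_trans nm; exact/ltW/emr_nondeg.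
Qed.

Fixpoint emr_lo (w : seq nat) : R :=
  if w is a :: w' then emr_inv a (emr_lo w') else 0.

Fixpoint emr_hi (w : seq nat) : R :=
  if w is a :: w' then emr_inv a (emr_hi w') else 1.

Lemma emr_inv_le n : {in `[0, 1] &, {mono emr_inv n : x y / x <= y}}.
Proof.
move=> x y x01 y01; rewrite -(@emr_branch_le n) ?emr_inv_in//.
by rewrite !emr_invK.
Qed.

Lemma emr_inv_lt n : {in `[0, 1] &, {mono emr_inv n : x y / x < y}}.
Proof. exact/leW_mono_in/emr_inv_le. Qed.

Lemma emr_itv01 n x : x \in `[l n, u n] -> x \in `[0, 1].
Proof. by move=> xn; apply: (@emr_sub _ T n). Qed.

Lemma emr_lo_in w : emr_lo w \in `[0, 1].
Proof.
case: w => [|a w] /=; first by rewrite in_itv/= lexx ler01.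
elim: w a => [|b w IH] a /=; apply: (@emr_itv01 a); apply: emr_inv_in.
  by rewrite in_itv/= lexx ler01.
exact: IH.
Qed.

Lemma emr_hi_in w : emr_hi w \in `[0, 1].
Proof.
elim: w => [|a w IH] /=; first by rewrite in_itv/= lexx ler01.
by apply: (@emr_itv01 a); exact: emr_inv_in.
Qed.

Lemma emr_lo_lt_hi w : emr_lo w < emr_hi w.
Proof.
by elim: w => [|a w IH] /=; rewrite ?ltr01// emr_inv_lt ?emr_lo_in ?emr_hi_in.
Qed.

(** The branches increase, so composed inverse branches carry 0 and 1 to the endpoints of the
    cylinder. *)
Lemma emr_cylE w : emr_cyl T w = `[emr_lo w, emr_hi w]%classic.
Proof.
elim: w => [//|a w IH] /=; rewrite IH /emr_I.
have lo01 := emr_lo_in w; have hi01 := emr_hi_in w.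
apply/seteqP; split=> x /=.
  move=> [xa]; rewrite in_itv/= => /andP[lx xh]; rewrite in_itv/=.
  rewrite -(@emr_branch_le a (emr_inv a _) x) ?emr_inv_in//.
  by rewrite -(@emr_branch_le a x) ?emr_inv_in// !emr_invK// lx.
rewrite in_itv/= => /andP[lx xh].
have xa : x \in `[l a, u a].
  have := emr_inv_in a lo01; have := emr_inv_in a hi01; rewrite !in_itv/=.
  by move=> /andP[_ hu] /andP[ll _]; rewrite (le_trans ll)//= (le_trans xh).
split => //; rewrite in_itv/=.
rewrite -(@emr_branch_le a (emr_inv a _) x) ?emr_inv_in// emr_invK// in lx.
by rewrite -(@emr_branch_le a x) ?emr_inv_in// emr_invK// in xh; rewrite lx.
Qed.

Lemma emr_inv0 n : emr_inv n 0 = l n.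
Proof.
have ln : l n \in `[l n, u n] by rewrite in_itv/= lexx ltW// emr_nondeg.
have o01 : (0:R) \in `[0, 1] by rewrite in_itv/= lexx ler01.
apply/eqP; rewrite eq_le; apply/andP; split; last first.
  by have := emr_inv_in n o01; rewrite in_itv/= => /andP[].
rewrite -(@emr_branch_le n) ?emr_inv_in// emr_invK//.
by have := emr_branch_in ln; rewrite in_itv/= => /andP[].
Qed.

Lemma emr_inv1 n : emr_inv n 1 = u n.
Proof.
have un : u n \in `[l n, u n] by rewrite in_itv/= lexx ltW// emr_nondeg.
have o01 : (1:R) \in `[0, 1] by rewrite in_itv/= lexx ler01.
apply/eqP; rewrite eq_le; apply/andP; split.
  by have := emr_inv_in n o01; rewrite in_itv/= => /andP[].
rewrite -(@emr_branch_le n) ?emr_inv_in// emr_invK//.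
by have := emr_branch_in un; rewrite in_itv/= => /andP[].
Qed.

Lemma len_itv (x y : R) : x <= y -> len `[x, y]%classic = y - x.
Proof.
by rewrite /len lebesgue_measure_itv/= lte_fin; case: ltgtP => // ->; rewrite subrr.
Qed.

Lemma len_cyl w : len (emr_cyl T w) = emr_hi w - emr_lo w.
Proof. by rewrite emr_cylE len_itv// ltW// emr_lo_lt_hi. Qed.

Lemma len_cyl_gt0 w : 0 < len (emr_cyl T w).
Proof. by rewrite len_cyl subr_gt0 emr_lo_lt_hi. Qed.

Lemma emr_rE n : emr_r T n = u n - l n.
Proof. by rewrite /emr_r /emr_I len_itv// ltW// emr_nondeg. Qed.

Lemma emr_r_gt0 n : 0 < emr_r T n.
Proof. by rewrite emr_rE subr_gt0 emr_nondeg. Qed.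

Lemma emr_r_lt1 n : emr_r T n < 1.
Proof. by rewrite emr_rE; have := emr_u_le1 n; have := emr_l_gt0 n; lra. Qed.

Lemma emr_cyl_cat w v : emr_cyl T (w ++ v) `<=` emr_cyl T w.
Proof.
elim: w => [|a w IH] /=; last by move=> x [xa]; split => //; exact: IH.
rewrite emr_cylE => x /=; have := emr_lo_in v; have := emr_hi_in v.
rewrite !in_itv/= => /andP[_ h1] /andP[l0 _] /andP[lx xh].
by rewrite (le_trans l0)//= (le_trans xh).
Qed.

Lemma mkseq_sshift (a : Sigma) n : mkseq a n.+1 = a 0%N :: mkseq (sshift a) n.
Proof.
apply: (@eq_from_nth _ 0%N) => [|i]; first by rewrite /= !size_map !size_iota.
rewrite size_mkseq => lin; rewrite nth_mkseq//.
by case: i lin => //= i lin; rewrite nth_mkseq.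
Qed.

Lemma mkseqD (a : Sigma) m n :
  mkseq a (m + n) = mkseq a m ++ mkseq (iter m sshift a) n.
Proof.
elim: m a => [//|m IH] a.
by rewrite addSn !mkseq_sshift IH cat_cons -iterSr.
Qed.

Lemma emr_cyl_decr (a : Sigma) m n : (m <= n)%N ->
  emr_cyl T (mkseq a n) `<=` emr_cyl T (mkseq a m).
Proof. by move=> /subnKC <-; rewrite mkseqD; exact: emr_cyl_cat. Qed.

Lemma emr_cyl_cap_nonempty (a : Sigma) :
  \bigcap_n emr_cyl T (mkseq a n) !=set0.
Proof.
pose S := [set emr_lo (mkseq a n) | n in [set: nat]].
have lohi m n : emr_lo (mkseq a m) <= emr_hi (mkseq a n).
  have [mn|/ltnW nm] := leqP m n.
    have /(_ (emr_hi (mkseq a n))) := @emr_cyl_decr a _ _ mn.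
    rewrite !emr_cylE /= !in_itv/= lexx ltW ?emr_lo_lt_hi// => /(_ isT).
    by case/andP.
  have /(_ (emr_lo (mkseq a m))) := @emr_cyl_decr a _ _ nm.
  rewrite !emr_cylE /= !in_itv/= lexx ltW ?emr_lo_lt_hi// => /(_ isT).
  by case/andP.
have S0 : S !=set0 by exists (emr_lo (mkseq a 0)); exists 0%N.
exists (sup S) => n _; rewrite emr_cylE /= in_itv/=; apply/andP; split.
  apply: ub_le_sup; last by exists n.
  by exists (emr_hi (mkseq a n)) => _ [m _ <-].
by apply: ge_sup => // _ [m _ <-].
Qed.

Lemma emr_pi_cyl (a : Sigma) n : emr_cyl T (mkseq a n) (emr_pi T a).
Proof.
rewrite /emr_pi; have [x Hx] := emr_cyl_cap_nonempty a.
have := @xgetI _ 0 (\bigcap_n emr_cyl T (mkseq a n)) x Hx.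
by apply.
Qed.

End emr_intervals.

Lemma is_derive_derive1 (R : realType) (f : R -> R) x :
  derivable f x 1 -> is_derive x 1 f (derive1 f x).
Proof. by move=> df; rewrite derive1E; exact: derivableP. Qed.

Lemma MVT_open (R : realType) (f df : R -> R) (a b : R) :
  (forall x, x \in `]a, b[ -> is_derive x 1 f (df x)) ->
  forall x y, x \in `]a, b[ -> y \in `]a, b[ ->
  exists2 c, c \in `]a, b[ & f x - f y = df c * (x - y).
Proof.
move=> dfE.
suff H x y : x <= y -> x \in `]a, b[ -> y \in `]a, b[ ->
    exists2 c, c \in `]a, b[ & f y - f x = df c * (y - x).
  move=> x y xab yab; have [xy|/ltW yx] := leP x y; last exact: H.
  have [c cab E] := H _ _ xy xab yab; exists c => //.
  by rewrite -[LHS]opprB E -mulrN opprB.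
move=> xy xab yab.
have sub z : z \in `[x, y] -> z \in `]a, b[.
  move: xab yab; rewrite !in_itv/= => /andP[ax _] /andP[_ yb] /andP[xz zy].
  by rewrite (lt_le_trans ax)//= (le_lt_trans zy).
have fxy z : z \in `]x, y[ -> is_derive z 1 f (df z).
  by move=> zxy; apply/dfE/sub; exact: subset_itv_oo_cc zxy.
have cf : {within `[x, y], continuous f}.
  by apply: derivable_within_continuous => z /sub/dfE[].
have [c cxy E] := MVT_segment xy fxy cf.
by exists c => //; exact: sub.
Qed.

Section emr_distortion.
Context {R : realType}.
Variable T : EMR_map R.
Local Notation l := (emr_l T).
Local Notation u := (emr_u T).
Local Notation br := (emr_branch T).

Lemma is_derive_emr_T n x : x \in `]l n, u n[ ->
  is_derive x 1 (emr_T T) (derive1 (emr_T T) x).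
Proof. by move=> /(@emr_C2 _ T n x)[/is_derive_derive1]. Qed.

Lemma is_derive_emr_branch n x : x \in `]l n, u n[ ->
  is_derive x 1 (br n) (derive1 (emr_T T) x).
Proof.
move=> xn; apply: near_eq_is_derive (is_derive_emr_T xn).
by near=> y; apply/esym/emr_branchE; near: y; exact: near_in_itvoo.
Unshelve. all: by end_near. Qed.

Lemma emr_inv_MVT n x y : 0 <= x -> x < y -> y <= 1 ->
  exists2 c, c \in `]l n, u n[ &
    y - x = derive1 (emr_T T) c * (emr_inv T n y - emr_inv T n x).
Proof.
move=> x0 xy y1.
have x01 : x \in `[0, 1] by rewrite in_itv/= x0 (le_trans (ltW xy)).
have y01 : y \in `[0, 1] by rewrite in_itv/= y1 (le_trans x0 (ltW xy)).
have ixy : emr_inv T n x < emr_inv T n y by rewrite emr_inv_lt.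
have := emr_inv_in T n x01; have := emr_inv_in T n y01.
rewrite !in_itv/= => /andP[_ yu] /andP[lx _].
have sub z : z \in `]emr_inv T n x, emr_inv T n y[ -> z \in `]l n, u n[.
  rewrite !in_itv/= => /andP[xz zy].
  by rewrite (le_lt_trans lx)//= (lt_le_trans zy).
have [c cxy E] : exists2 c, c \in `]emr_inv T n x, emr_inv T n y[ &
    br n (emr_inv T n y) - br n (emr_inv T n x) =
    derive1 (emr_T T) c * (emr_inv T n y - emr_inv T n x).
  apply: (@MVT R _ (derive1 (emr_T T)) _ _ ixy) => [z /sub|].
    exact: is_derive_emr_branch.
  apply: (@continuous_subspaceW _ _ _ `[l n, u n]%classic (br n) _
    (@emr_branch_continuous _ T n)) => z /=.
  rewrite !in_itv/= => /andP[xz zy].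
  by rewrite (le_trans lx)//= (le_trans zy).
by exists c; [exact: sub|rewrite -E !emr_invK].
Qed.

(** Each increment ratio of an inverse branch is [1 / T'] at some point [c] of I(n), and the full
    increment gives a point [e] with [T' e = 1 / r]. Renyi's condition compares the two slopes:
    through [T'] it gives [T' c <= (1 + E) / r], and through [1 / T'] it gives
    [1 / T' c <= (1 + E) r]. *)
Lemma emr_distortion : exists2 D : R, 1 <= D &
  forall n x y, 0 <= x -> x < y -> y <= 1 ->
  emr_r T n * (y - x) <= D * (emr_inv T n y - emr_inv T n x) /\
  emr_inv T n y - emr_inv T n x <= D * (emr_r T n * (y - x)).
Proof.
have [E [E0 HE]] := emr_renyi T; exists (1 + E) => [|n x y x0 xy y1].
  by rewrite lerDl ltW.
have [c cn Ec] := emr_inv_MVT n x0 xy y1.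
have [e en Ee] := emr_inv_MVT n (lexx 0) ltr01 (lexx 1).
rewrite emr_inv0 emr_inv1 -emr_rE subr0 in Ee.
set dT := derive1 (emr_T T) in Ec Ee *.
set r := emr_r T n in Ee *; have r0 : 0 < r := emr_r_gt0 T n.
set v := emr_inv T n y - emr_inv T n x in Ec *.
have v0 : 0 < v.
  rewrite subr_gt0 emr_inv_lt// in_itv/= ?x0 ?y1 ?(ltW (le_lt_trans x0 xy))//.
  by rewrite (ltW (lt_le_trans xy y1)).
have dc0 : 0 < dT c by rewrite -(pmulr_lgt0 _ v0) -Ec subr_gt0.
have de0 : 0 < dT e by rewrite -(pmulr_lgt0 _ r0) -Ee ltr01.
have ce : `|c - e| <= r.
  move: cn en; rewrite !in_itv/= => /andP[? ?] /andP[? ?].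
  by rewrite /r emr_rE ler_norml; apply/andP; split; lra.
have ddT z : z \in `]l n, u n[ -> is_derive z 1 dT (derive1 dT z).
  by move=> zn; have [_ d2 _] := emr_C2 zn; exact: (is_derive_derive1 d2).
have dVT z : z \in `]l n, u n[ ->
    is_derive z 1 (fun y => (dT y)^-1) (- dT z ^- 2 *: derive1 dT z).
  by move=> zn; exact: (is_deriveV (emr_deriv_neq0 zn) (ddT z zn)).
have [z1 z1n E1] := MVT_open ddT cn en.
have [z2 z2n E2] := MVT_open dVT cn en.
(* Two of the points in Renyi's condition are put at [e], where [T'] is [1 / r]; over a distance at
   most [r] the variation of [T'] is then at most [E / r]. *)
have B1 : `|derive1 dT z1| <= E * (dT e * dT e).
  have := HE n z1 e e z1n en en; rewrite ler_pdivrMr ?mulr_gt0 ?normr_gt0 ?gt_eqF//.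
  by rewrite (gtr0_norm de0).
(* The derivative of [1 / T'] is, up to sign, the quotient in Renyi's condition with all three
   points equal. *)
have B2 : `|- dT z2 ^- 2 *: derive1 dT z2| <= E.
  have := HE n z2 z2 z2 z2n z2n z2n.
  rewrite normrZ normrN normfV normrX mulrC expr2; exact.
have dE : dT e = r^-1 by rewrite -[LHS](mulfK (lt0r_neq0 r0)) -Ee mul1r.
split.
- have H : dT c <= (1 + E) * r^-1.
    have : `|dT c - dT e| <= E * (dT e * dT e) * r.
      by rewrite E1 normrM ler_pM.
    rewrite dE -mulrA (mulrAC r^-1) mulVf ?gt_eqF// mul1r => /ler_normlP[_ H].
    by rewrite mulrDl mul1r; lra.
  rewrite Ec mulrA; apply: ler_wpM2r; first exact: ltW.
  by rewrite mulrC -ler_pdivlMr.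
- have H : (dT c)^-1 <= (1 + E) * r.
    have : `|(dT c)^-1 - (dT e)^-1| <= E * r by rewrite E2 normrM ler_pM.
    by rewrite dE invrK => /ler_normlP[_ ?]; rewrite mulrDl mul1r; lra.
  rewrite Ec !mulrA -[leLHS]mul1r; apply: ler_wpM2r; first exact: ltW.
  by rewrite -ler_pdivrMr// mul1r.


Qed.

End emr_distortion.

(** * The coding map *)

Section emr_coding_map.
Context {R : realType}.
Variable T : EMR_map R.
Local Notation l := (emr_l T).
Local Notation u := (emr_u T).
Local Notation br := (emr_branch T).
Local Notation lo := (emr_lo T).
Local Notation hi := (emr_hi T).
Local Notation pi := (emr_pi T).

Lemma lo_cons_ge a w : l a <= lo (a :: w).
Proof.
by have := emr_inv_in T a (emr_lo_in T w); rewrite in_itv/= => /andP[].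
Qed.

Lemma hi_cons_le a w : hi (a :: w) <= u a.
Proof.
by have := emr_inv_in T a (emr_hi_in T w); rewrite in_itv/= => /andP[].
Qed.

Lemma emr_branch_cyl_oo a w x : x \in `](lo (a :: w)), (hi (a :: w))[ ->
  (x \in `]l a, u a[) /\ (br a x \in `]lo w, hi w[).
Proof.
rewrite in_itv/= => /andP[lx xh].
have xa : x \in `]l a, u a[.
  rewrite in_itv/= (le_lt_trans (lo_cons_ge a w) lx).
  by rewrite (lt_le_trans xh (hi_cons_le a w)).
split => //; have xa' : x \in `[l a, u a] by exact: subset_itv_oo_cc xa.
rewrite in_itv/= -[lo w](@emr_invK _ T a) ?emr_lo_in//.
rewrite -[hi w](@emr_invK _ T a) ?emr_hi_in//.
by rewrite !emr_branch_lt ?emr_inv_in ?emr_lo_in ?emr_hi_in// lx.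
Qed.

Lemma iter_emr_T_cat w v x : x \in `](lo (w ++ v)), (hi (w ++ v))[ ->
  iter (size w) (emr_T T) x \in `]lo v, hi v[.
Proof.
elim: w x => [//|a w IH] x /emr_branch_cyl_oo[xa bx].
by rewrite [size _]/= iterSr -(emr_branchE xa); exact: IH.
Qed.

Lemma iter_emr_T_derivable w x : x \in `]lo w, hi w[ ->
  derivable (iter (size w) (emr_T T)) x 1.
Proof.
elim: w x => [|a w IH] x; first by move=> _; exact: derivable_id.
move=> /emr_branch_cyl_oo[xa bx].
have -> : iter (size (a :: w)) (emr_T T) = iter (size w) (emr_T T) \o emr_T T.
  by apply/funext => y; rewrite /= -iterS iterSr.
apply/derivable1_diffP; apply: differentiable_comp.
  by apply/derivable1_diffP; have [] := emr_C2 xa.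
by apply/derivable1_diffP; rewrite -(emr_branchE xa); exact: IH.
Qed.

Lemma lo_cat w v : lo w <= lo (w ++ v).
Proof.
have /(_ (lo (w ++ v))) := @emr_cyl_cat _ T w v.
rewrite !emr_cylE /= !in_itv/= lexx ltW ?emr_lo_lt_hi// => /(_ isT).
by case/andP.
Qed.

Lemma hi_cat w v : hi (w ++ v) <= hi w.
Proof.
have /(_ (hi (w ++ v))) := @emr_cyl_cat _ T w v.
rewrite !emr_cylE /= !in_itv/= lexx ltW ?emr_lo_lt_hi// => /(_ isT).
by case/andP.
Qed.

(** On the interior of the longer cylinder the [r]-th iterate of [T] has slope at least [al] in
    absolute value and takes values inside the cylinder of [v]. *)
Lemma emr_cyl_contraction : exists (r : nat) (al : R), [/\ (0 < r)%N, 1 < al &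
  forall w v, size w = r -> al * (hi (w ++ v) - lo (w ++ v)) <= hi v - lo v].
Proof.
have [r [al [r0 al1 H]]] := emr_expanding T; exists r, al; split => // w v wr.
have al0 : 0 < al by exact: lt_trans al1.
set f := iter r (emr_T T) in H.
have sub x : x \in `](lo (w ++ v)), (hi (w ++ v))[ -> x \in `]lo w, hi w[.
  rewrite !in_itv/= => /andP[lx xh].
  by rewrite (le_lt_trans (lo_cat w v))//= (lt_le_trans xh)// hi_cat.
have df x : x \in `](lo (w ++ v)), (hi (w ++ v))[ -> is_derive x 1 f (derive1 f x).
  move=> /sub xw; apply: (@is_derive_derive1 R f x).
  by rewrite /f -wr; exact: iter_emr_T_derivable.
have dfal x : x \in `](lo (w ++ v)), (hi (w ++ v))[ -> al <= `|derive1 f x|.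
  move=> xv; have xw := sub x xv; have dx := iter_emr_T_derivable xw.
  have [a [w' wE]] : exists a w', w = a :: w'.
    by case: (w) wr => [r00|a w' _]; [rewrite -r00 in r0|exists a, w'].
  move: xw; rewrite wE => /emr_branch_cyl_oo[xa _].
  by apply: (H a) => //; rewrite /f -wr.
rewrite leNgt; apply/negP; rewrite -ltr_pdivrMl// mulrC => Hlt.
set L := hi v - lo v in Hlt.
have lh := emr_lo_lt_hi T (w ++ v).
(* A quarter of the supposed excess over [L / al]: moving both endpoints inwards by [e] reaches
   points where the iterate is differentiable and still leaves a distance above [L / al]. *)
set e := (hi (w ++ v) - lo (w ++ v) - L / al) / 4%:R.
have e0 : 0 < e by rewrite divr_gt0 ?subr_gt0.
have L0 : 0 < L / al by rewrite divr_gt0 ?subr_gt0 ?emr_lo_lt_hi.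
have eE : hi (w ++ v) - lo (w ++ v) = L / al + 4%:R * e.
  by rewrite /e; lra.
pose x := lo (w ++ v) + e; pose y := hi (w ++ v) - e.
have xw : x \in `](lo (w ++ v)), (hi (w ++ v))[.
  by rewrite in_itv/= /x; apply/andP; split; lra.
have yw : y \in `](lo (w ++ v)), (hi (w ++ v))[.
  by rewrite in_itv/= /y; apply/andP; split; lra.
have [c cw Ec] := MVT_open df yw xw.
have xy : y - x = L / al + 2%:R * e by rewrite /x /y; lra.
have yx0 : 0 < y - x by rewrite xy; lra.
have fL : `|f y - f x| <= L.
  have := iter_emr_T_cat xw; have := iter_emr_T_cat yw; rewrite wr -/f !in_itv/=.
  move=> /andP[? ?] /andP[? ?]; rewrite ler_norml /L; apply/andP; split; lra.
move: fL; rewrite Ec normrM (gtr0_norm yx0) => fL.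
have : al * (y - x) <= L.
  by apply: le_trans fL; apply: ler_wpM2r; [exact: ltW|exact: dfal].
have -> : al * (y - x) = L + al * (2%:R * e).
  by rewrite xy mulrDr [al * (L / al)]mulrC divfK// gt_eqF.
have : 0 < al * (2%:R * e).
  by apply: mulr_gt0 => //; apply: mulr_gt0 => //; rewrite ltr0n.
lra.
Qed.

Lemma len_cyl_small (a : Sigma) (eps : R) : 0 < eps ->
  exists n, len (emr_cyl T (mkseq a n)) < eps.
Proof.
move=> eps0; have [r [al [r0 al1 H]]] := emr_cyl_contraction.
have al0 : 0 < al by exact: lt_trans al1.
have B n b : al ^+ n * len (emr_cyl T (mkseq b (r * n))) <= 1.
  elim: n b => [|n IH] b; first by rewrite muln0 mul1r len_cyl /= subr0.
  rewrite mulnS mkseqD exprSr -mulrA.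
  apply: le_trans (IH (iter r sshift b)).
  by rewrite ler_pM2l ?exprn_gt0// !len_cyl; apply: H; rewrite size_mkseq.
have [n Hn] : exists n, (al ^+ n)^-1 < eps.
  have alV : `|al^-1| < 1 by rewrite gtr0_norm ?invr_gt0// invf_lt1.
  have /cvgrPdist_lt/(_ eps eps0)[n _ Hn] := cvg_expr alV.
  exists n; have := Hn n (leqnn n); rewrite sub0r normrN exprVn gtr0_norm//.
  by rewrite invr_gt0 exprn_gt0.
exists (r * n)%N; have := B n a.
by rewrite -ler_pdivlMl ?exprn_gt0// mulr1 => /le_lt_trans; exact.
Qed.

Lemma emr_pi_unique (a : Sigma) x :
  (forall n, emr_cyl T (mkseq a n) x) -> x = pi a.
Proof.
move=> Hx; apply/eqP; rewrite -subr_eq0 -normr_eq0; apply/negPn/negP => d0.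
have {}d0 : 0 < `|x - pi a| by rewrite lt0r d0/=.
have [n] := len_cyl_small a d0; have := Hx n; have := emr_pi_cyl T a n.
rewrite len_cyl emr_cylE /= !in_itv/= => /andP[? ?] /andP[? ?].
by apply/negP; rewrite -leNgt ler_norml; apply/andP; split; lra.
Qed.

Lemma emr_pi_in (a : Sigma) : pi a \in `[l (a 0%N), u (a 0%N)].
Proof. by have [] := emr_pi_cyl T a 1. Qed.

Lemma emr_pi_shift (a : Sigma) : br (a 0%N) (pi a) = pi (sshift a).
Proof.
apply: emr_pi_unique => n; have := emr_pi_cyl T a n.+1.
by rewrite mkseq_sshift => -[].
Qed.

Lemma emr_pi_gt0 (a : Sigma) : 0 < pi a.
Proof.
have := emr_pi_in a; rewrite in_itv/= => /andP[+ _].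
by apply: lt_le_trans; exact: emr_l_gt0.
Qed.

(** The point 0 lies in no I(n), so coded points are positive, and the strictly increasing branches
    carry this over to the left endpoints of all cylinders. *)
Lemma emr_pi_gt_lo (a : Sigma) n : lo (mkseq a n) < pi a.
Proof.
elim: n a => [|n IH] a; first exact: emr_pi_gt0.
rewrite mkseq_sshift /= -(@emr_branch_lt _ T (a 0%N)) ?emr_pi_in//; last first.
  by rewrite emr_inv_in// emr_lo_in.
by rewrite emr_invK ?emr_lo_in// emr_pi_shift.
Qed.

Lemma emr_pi_gt_l (a : Sigma) : l (a 0%N) < pi a.
Proof. by have := emr_pi_gt_lo a 1; rewrite /= emr_inv0. Qed.

Lemma emr_itv_eq a b x : l a < x <= u a -> l b < x <= u b -> a = b.
Proof.
move=> /andP[ax xa] /andP[bx xb]; have [ab|ba|//] := ltngtP a b.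
  by have := lt_le_trans ax (le_trans xb (emr_u_le_l T ab)); rewrite ltxx.
by have := lt_le_trans bx (le_trans xa (emr_u_le_l T ba)); rewrite ltxx.
Qed.

Lemma emr_pi_oc (a : Sigma) : l (a 0%N) < pi a <= u (a 0%N).
Proof.
by rewrite emr_pi_gt_l; have := emr_pi_in a; rewrite in_itv/= => /andP[].
Qed.

(** Injectivity holds on the whole shift space: coded points lie in the half-open intervals []l n, u
    n]], which are disjoint and thus determine the first symbol; the branch then passes to the next
    one. *)
Lemma emr_pi_inj : injective pi.
Proof.
move=> a b ab; apply/funext => i; elim: i a b ab => [|i IH] a b ab.
  by apply: emr_itv_eq (emr_pi_oc a) _; rewrite ab; exact: emr_pi_oc.
apply: (IH (sshift a) (sshift b)).
rewrite -!emr_pi_shift ab; congr (br _ _).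
by apply: emr_itv_eq (emr_pi_oc a) _; rewrite ab; exact: emr_pi_oc.
Qed.

Lemma emr_coding_pi (a : Sigma) : emr_coding T (pi a) = a.
Proof.
rewrite /emr_coding; apply: emr_pi_inj.
exact: (@xgetI _ (fun=> 0%N) [set b : Sigma | pi b = pi a] a erefl).
Qed.

Lemma emr_branch_u n : br n (u n) = 1.
Proof. by rewrite -emr_inv1 emr_invK// in_itv/= lexx ler01. Qed.

Lemma emr_pi_eq1 (a : Sigma) : pi a = 1 -> a = fun=> 0%N.
Proof.
move=> a1; apply/funext => i; elim: i a a1 => [|i IH] a a1; last first.
  apply: (IH (sshift a)); rewrite -emr_pi_shift a1.
  have := emr_pi_oc a; rewrite a1 => /andP[_ u1].
  have uE : u (a 0%N) = 1 by apply/eqP; rewrite eq_le u1 emr_u_le1.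
  by rewrite -{1}uE emr_branch_u.
have := emr_pi_oc a; rewrite a1; case: (a 0%N) => // n /andP[_ un].
have := lt_le_trans (emr_nondeg T 0) (emr_u_le1 T 0).
by rewrite ltNge (le_trans un)//; exact: emr_u_le_l.
Qed.

(* The codings of the right endpoints of the cylinders other than 1. *)
Definition last_nonzero (n : nat) : set Sigma :=
  [set a | (0 < a n)%N /\ forall i, (n < i)%N -> a i = 0%N].

Lemma emr_pi_right (a : Sigma) : pi a = u (a 0%N) -> sshift a = fun=> 0%N.
Proof.
by move=> au; apply: emr_pi_eq1; rewrite -emr_pi_shift au emr_branch_u.
Qed.

(** If the coding does not start with [w], some iterate sits on the right endpoint of its own
    interval. The branch sends that endpoint to 1, which only the zero sequence can code. *)
Lemma emr_cyl_pi w (a : Sigma) : emr_cyl T w (pi a) ->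
  Scyl w a \/ exists n, last_nonzero n a.
Proof.
elim: w a => [|b w IH] a; first by left.
move=> [+ bx]; rewrite /emr_I /= in_itv/= => /andP[lb ub].
have [ab|ab|ab] := ltngtP (a 0%N) b.
- have := lt_le_trans (emr_pi_gt_l a) (le_trans ub (emr_u_le_l T ab)).
  by rewrite ltxx.
- right; exists 0%N; split; first exact: leq_ltn_trans ab.
  have /andP[_ au] := emr_pi_oc a.
  have /emr_pi_right E : pi a = u (a 0%N).
    by apply/eqP; rewrite eq_le au (le_trans (emr_u_le_l T ab)).
  by case=> // i _; rewrite (_ : a i.+1 = sshift a i)// E.
- move: bx; rewrite /= -ab emr_pi_shift => /IH[cw|[n [n0 Hn]]].
    by left; rewrite /Scyl /= mkseq_sshift; congr (_ :: _).
  by right; exists n.+1; split=> // -[//|i] ni; exact: Hn.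
Qed.

Lemma Scyl_emr_cyl w (a : Sigma) : Scyl w a -> emr_cyl T w (pi a).
Proof. by move=> /ScylE ->; exact: emr_pi_cyl. Qed.

(** [T] is tied to the branches only inside the I(n). Coded points avoid left endpoints, and
    reaching a right endpoint would make the next shift the zero sequence. *)
Lemma iter_emr_T_pi (a : Sigma) n :
  (forall k, iter k sshift a <> (fun=> 0%N)) ->
  iter n (emr_T T) (pi a) = pi (iter n sshift a).
Proof.
move=> Ha; elim: n => [//|n IH]; rewrite iterS IH iterS.
set b := iter n sshift a; rewrite -emr_pi_shift.
have /andP[lb ub] := emr_pi_oc b.
have [E|ne] := eqVneq (pi b) (u (b 0%N)).
  by case: (Ha n.+1); exact: emr_pi_right.
by rewrite (@emr_branchE _ T)// in_itv/= lb lt_neqAle ne.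
Qed.

Lemma measurable_emr_pi : measurable_fun setT pi.
Proof.
apply: (@measurability _ _ _ _ setT pi _ (RGenOInfty.measurableE R)).
move=> _ [_ [x ->] <-]; rewrite setTI; apply: cyl_open_measurable => a.
rewrite /= in_itv/= andbT => xa.
have [n Hn] : exists n, len (emr_cyl T (mkseq a n)) < pi a - x.
  by apply: len_cyl_small; rewrite subr_gt0.
exists n => b /Scyl_emr_cyl; have := emr_pi_cyl T a n; move: Hn.
rewrite len_cyl emr_cylE /= !in_itv/= andbT => ? /andP[? ?] /andP[? ?]; lra.
Qed.

(** Without their left endpoints the cylinders of a given length are disjoint, and they still
    contain every point coded by their word. *)
Definition emr_J (w : seq nat) : set R := emr_cyl T w `\ lo w.

Lemma emr_J_pi (a : Sigma) n : emr_J (mkseq a n) (pi a).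
Proof.
split; first exact: emr_pi_cyl.
by move=> /= E; have := emr_pi_gt_lo a n; rewrite E ltxx.
Qed.

Lemma emr_JP w x : emr_J w x <-> lo w < x <= hi w.
Proof.
rewrite /emr_J emr_cylE /setD /= in_itv/=; split.
  by move=> [/andP[lx ->] /eqP xl]; rewrite andbT lt_neqAle eq_sym xl.
by move=> /andP[lx ->]; rewrite ltW//; split => // E; rewrite E ltxx in lx.
Qed.

Lemma emr_J_cons a w x : emr_J (a :: w) x ->
  l a < x <= u a /\ emr_J w (br a x).
Proof.
move=> Jx; have /emr_JP/andP[lx xh] := Jx.
have xa : l a < x <= u a.
  by rewrite (le_lt_trans (lo_cons_ge a w))//= (le_trans xh)// hi_cons_le.
have xa' : x \in `[l a, u a].
  by move: xa => /andP[? ?]; rewrite in_itv/= ltW.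
split => //; case: Jx => -[_ bx] _; split => //= E.
by move: lx; rewrite /= -E emr_branchK// ltxx.
Qed.

Lemma emr_J_cat w v : emr_J (w ++ v) `<=` emr_J w.
Proof.
move=> x /emr_JP/andP[lx xh]; apply/emr_JP.
by rewrite (le_lt_trans (lo_cat w v))//= (le_trans xh)// hi_cat.
Qed.

Lemma emr_J_eq w v x : size w = size v -> emr_J w x -> emr_J v x -> w = v.
Proof.
elim: w v x => [|a w IH] [|b v] x //= [wv] /emr_J_cons[xa Jw].
move=> /emr_J_cons[xb Jv]; have ab := emr_itv_eq xa xb.
by rewrite -ab in Jv *; rewrite (IH v _ wv Jw Jv).
Qed.

Lemma measurable_emr_J w : measurable (emr_J w).
Proof. by rewrite /emr_J emr_cylE; exact: measurableD. Qed.

Definition emr_G : set R :=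
  \bigcap_n \bigcup_(w in [set w : seq nat | size w = n]) emr_J w.

Lemma measurable_emr_G : measurable emr_G.
Proof.
apply: bigcapT_measurable => n; rewrite bigcup_mkcond.
apply: countable_bigcupT_measurable => // w.
by case: ifP => // _; exact: measurable_emr_J.
Qed.

(** A point of [emr_G] determines one word of each length, and these words extend one another
    because the sets [emr_J] of equal length are disjoint. The range is therefore Borel. *)
Lemma emr_pi_range : range pi = emr_G.
Proof.
apply/seteqP; split=> [_ [a _ <-] n _|x Gx].
  by exists (mkseq a n); [exact: size_mkseq|exact: emr_J_pi].
have /choice[W HW] n : exists w : seq nat, size w = n /\ emr_J w x.
  by have [w wn Jw] := Gx n I; exists w.
pose a : Sigma := fun n => nth 0%N (W n.+1) n.
have aW n : mkseq a n = W n.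
  elim: n => [|n IH]; first by have [/size0nil ->] := HW 0%N.
  have [sW JW] := HW n; have [sW1 JW1] := HW n.+1.
  have tW : take n (W n.+1) = W n.
    apply: (@emr_J_eq _ _ x) => //; first by rewrite size_takel ?sW ?sW1.
    by apply: (@emr_J_cat _ (drop n (W n.+1))); rewrite cat_take_drop.
  rewrite mkseqS IH -tW /a -take_nth ?sW1//.
  by rewrite take_oversize ?sW1.
exists a => //; apply/esym/emr_pi_unique => n.
by rewrite aW; have [_ []] := HW n.
Qed.

(** Complements are handled by injectivity and the Borel range. This lets exceptional sets found on
    the shift be transported to the interval. *)
Lemma measurable_image_emr_pi (B : set Sigma) :
  measurable B -> measurable (pi @` B).
Proof.
apply: (@Sigma_measurable_ind [set B | measurable (pi @` B)]); last first.
  move=> w /=; have -> : pi @` Scyl w = emr_G `&` emr_J w.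
    rewrite -emr_pi_range; apply/seteqP; split=> [_ [a aw <-]|_ [[a _ <-] Jw]].
      by split; [exists a|rewrite (ScylE aw); exact: emr_J_pi].
    exists a => //; apply: (@emr_J_eq _ _ (pi a)) => //; first by rewrite size_mkseq.
    exact: emr_J_pi.
  apply: measurableI; [exact: measurable_emr_G|exact: measurable_emr_J].
split => /=.
- by rewrite image_set0.
- move=> A mA; have -> : pi @` (setT `\` A) = emr_G `\` (pi @` A).
    rewrite -emr_pi_range; apply/seteqP; split=> [_ [a [_ Aa] <-]|_ [[a _ <-] na]].
      by split; [exists a|move=> [b Ab /emr_pi_inj ba]; rewrite -ba in Aa].
    by exists a => //; split => // Aa; apply: na; exists a.
  by apply: measurableD => //; exact: measurable_emr_G.
- by move=> F mF; rewrite image_bigcup; exact: bigcupT_measurable.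
Qed.

End emr_coding_map.

(** * Shift-invariant and Gibbs measures *)

Lemma measure_eq_off_null d (X : measurableType d) (R : realType)
    (m : {measure set X -> \bar R}) (A B N : set X) :
  measurable A -> measurable B -> m.-negligible N ->
  A `<=` B `|` N -> B `<=` A `|` N -> m A = m B.
Proof.
move=> mA mB [M [mM M0 NM]] AB BA.
suff H C D : measurable C -> measurable D -> C `<=` D `|` N -> (m C <= m D)%E.
  by apply/eqP; rewrite eq_le !H.
move=> mC mD CD; apply: (@le_trans _ _ (m (D `|` M))).
  apply: le_measure; rewrite ?inE//; first exact: measurableU.
  by move=> x /CD[]; [left|right; exact: NM].
by apply: le_trans (measureU2 m mD mM) _; rewrite /= M0 adde0.
Qed.

Section shift_measure.
Context {R : realType}.
Variable mu : probability Sigma R.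
Hypothesis inv_mu : invariant_measure mu sshift.

Definition zeros : Sigma := fun=> 0%N.

Lemma measurable_zeros : measurable [set zeros].
Proof.
have -> : [set zeros] = \bigcap_n Scyl (mkseq zeros n).
  apply/seteqP; split=> [a -> n _|a H]; first exact: Scyl_mkseq.
  by apply/funext => i; have /Scyl_mkseqE/(_ i (ltnSn i)) := H i.+1 I.
by apply: bigcapT_measurable => n; exact: measurable_Scyl.
Qed.

Lemma last_nonzeroE n :
  last_nonzero n = iter n sshift @^-1` last_nonzero 0.
Proof.
apply/seteqP; split=> a [/= a0 Ha]; rewrite ?sshiftE ?addn0 in a0 *.
  split=> [|i i0]; rewrite ?sshiftE ?addn0//.
  by apply: Ha; rewrite -[X in (X < _)%N]addn0 ltn_add2l.
split=> // i /subnKC <-; rewrite addSnnS -sshiftE; exact: Ha.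
Qed.

Lemma last_nonzero0E : last_nonzero 0 = sshift @^-1` [set zeros] `\` [set zeros].
Proof.
apply/seteqP; split=> a /=.
  move=> [a0 Ha]; split; first by apply/funext => i; exact: Ha.
  by move=> az; rewrite az in a0.
move=> [az anz]; have Ha i : (0 < i)%N -> a i = 0%N.
  by case: i => // i _; rewrite -[RHS]/(zeros i) -az.
split=> //; rewrite lt0n; apply/eqP => a0; apply: anz.
by apply/funext => -[//|i]; exact: Ha.
Qed.

Lemma measurable_shift_preimage n (A : set Sigma) :
  measurable A -> measurable (iter n sshift @^-1` A).
Proof.
move=> mA; rewrite -[X in measurable X]setTI.
exact: (measurable_iter measurable_sshift).
Qed.

(** The zero sequence is fixed by the shift, so its singleton lies in its own preimage, which has
    the same measure by invariance; the difference is null, and so are its preimages. *)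
Lemma last_nonzero_null n : mu (last_nonzero n) = 0%E.
Proof.
have mz := measurable_zeros.
have msz : measurable (sshift @^-1` [set zeros]).
  exact: (@measurable_shift_preimage 1).
have ml : measurable (last_nonzero 0) by rewrite last_nonzero0E; exact: measurableD.
rewrite last_nonzeroE (invariant_iter measurable_sshift)// last_nonzero0E.
have := measureDI mu msz mz; rewrite /= inv_mu//.
have -> : sshift @^-1` [set zeros] `&` [set zeros] = [set zeros].
  by apply/seteqP; split=> [a []|a /= ->].
have : mu [set zeros] \is a fin_num by exact: fin_num_measure.
move: (mu [set zeros]) (mu (_ `\` _)) => [x| |] [y| |] // _.
by rewrite -EFinD => /eqP; rewrite eqe => /eqP E; congr (_%:E); lra.
Qed.

Lemma last_nonzero_negligible : mu.-negligible (\bigcup_n last_nonzero n).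
Proof.
apply: negligible_bigcup => n; apply/negligibleP; last exact: last_nonzero_null.
rewrite last_nonzeroE; apply: measurable_shift_preimage; rewrite last_nonzero0E.
apply: measurableD; last exact: measurable_zeros.
by apply: (@measurable_shift_preimage 1); exact: measurable_zeros.
Qed.

Definition eventually_zeros : set Sigma :=
  \bigcup_n (iter n sshift @^-1` [set zeros]).

(** The set is exactly shift invariant. If it had full measure, the cylinder of the symbol 1 would
    be null, since an eventually zero point of that cylinder has a last nonzero symbol. *)
Lemma eventually_zeros_negligible : ergodic mu sshift ->
  mu (Scyl [:: 1%N]) != 0%E -> mu.-negligible eventually_zeros.
Proof.
move=> erg mu1; have mN : measurable eventually_zeros.
  apply: bigcupT_measurable => n; apply: measurable_shift_preimage.
  exact: measurable_zeros.
apply/negligibleP => //.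
have invN : sshift @^-1` eventually_zeros = eventually_zeros.
  apply/seteqP; split=> a [n _ /= an].
    by exists n.+1 => //; rewrite /= -iterS iterSr.
  by exists n => //; rewrite /= -iterSr iterS an.
have [//|N1] := erg _ mN invN; case/eqP: mu1.
apply: (measure_negligible (measurable_Scyl _)).
have sub : Scyl [:: 1%N] `<=` ~` eventually_zeros `|` \bigcup_n last_nonzero n.
  move=> a a1; have [[n _ /= an]|] := pselect (eventually_zeros a); last by left.
  have a0 : a 0%N = 1%N by case: a1.
  right; have Ha i : (n <= i)%N -> a i = 0%N.
    by move=> /subnKC <-; rewrite -sshiftE an.
  elim: n Ha {an} => [|n IH] Ha; first by have := Ha 0%N isT; rewrite a0.
  have [an|an] := eqVneq (a n) 0%N.
    by apply: IH => i; rewrite leq_eqVlt => /orP[/eqP <-//|]; exact: Ha.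
  by exists n => //; split; [rewrite lt0n|].
apply: negligibleS sub _; apply: negligibleU; last exact: last_nonzero_negligible.
apply/negligibleP; first exact: measurableC.
by rewrite /= probability_setC// N1 subee.
Qed.

Section gibbs.
Variables (g : Sigma -> R) (gibbs_mu : gibbs_measure mu g 0).

Lemma gibbs_ln_bound : exists2 C : R, 0 <= C &
  forall w a, Scyl w a -> 0 < fine (mu (Scyl w)) /\
    `|ln (fine (mu (Scyl w))) - birkhoff_sum g (size w) a| <= C.
Proof.
have [_ [A [B [A0 B0 H]]]] := gibbs_mu; exists (`|ln A| + `|ln B|).
  by rewrite addr_ge0.
move=> w a /H; rewrite mulr0 oppr0 add0r.
set M := fine _; set S := birkhoff_sum _ _ _ => /andP[AM MB].
have M0 : 0 < M.
  by rewrite -(pmulr_lgt0 _ (x := expR (- S)))// ?expR_gt0// expRN (lt_le_trans A0).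
split=> //; have E : ln (M / expR S) = ln M - S.
  by rewrite lnM ?posrE ?invr_gt0 ?expR_gt0// lnV ?posrE ?expR_gt0// expRK.
have Q0 : 0 < M / expR S by rewrite divr_gt0 ?expR_gt0.
have := AM; rewrite -ler_ln ?posrE// E; have := MB; rewrite -ler_ln ?posrE// E.
have := ler_norm (ln B); have := ler_norm (- ln A); rewrite normrN.
have := normr_ge0 (ln A); have := normr_ge0 (ln B).
by rewrite ler_norml => *; apply/andP; split; lra.
Qed.

Lemma Scyl_nonempty w : exists a, Scyl w a.
Proof.
exists (nth 0%N w); apply: (@eq_from_nth _ 0%N); rewrite ?size_mkseq// => i iw.
by rewrite nth_mkseq.
Qed.

Lemma Scyl_gt0 w : 0 < fine (mu (Scyl w)).
Proof.
have [C _ H] := gibbs_ln_bound; have [a aw] := Scyl_nonempty w.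
by have [] := H w a aw.
Qed.

Definition cyl1_mass (n : nat) : R := fine (mu (Scyl [:: n])).

Lemma cyl1_mass_le1 n : cyl1_mass n <= 1.
Proof.
rewrite -lee_fin /cyl1_mass fineK ?fin_num_measure//; last exact: measurable_Scyl.
by apply: probability_le1; exact: measurable_Scyl.
Qed.

(** The Gibbs bound is used once for the cylinder of length [n] and once for each of its [n]
    symbols, whence the factor [n + 1]. *)
Lemma gibbs_quasi_product : exists2 C : R, 0 <= C & forall (a : Sigma) n,
  `|ln (fine (mu (Scyl (mkseq a n)))) - \sum_(k < n) ln (cyl1_mass (a k))|
  <= n.+1%:R * C.
Proof.
have [C C0 H] := gibbs_ln_bound; exists C => // a n.
have [_] := H _ a (Scyl_mkseq a n); rewrite size_mkseq /birkhoff_sum => Hn.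
have Hs : `|\sum_(k < n) g (iter k sshift a) - \sum_(k < n) ln (cyl1_mass (a k))|
    <= n%:R * C.
  rewrite -sumrB; apply: le_trans (ler_norm_sum _ _ _) _.
  rewrite -[n in n%:R]card_ord mulr_natl -sumr_const; apply: ler_sum => k _.
  have [|_] := H [:: a k] (iter k sshift a).
    by rewrite /Scyl /= /mkseq /= sshiftE addn0.
  by rewrite /birkhoff_sum big_ord1 distrC.
rewrite -natr1 mulrDl mul1r.
have := ler_normD (ln (fine (mu (Scyl (mkseq a n)))) - \sum_(k < n) g (iter k sshift a))
  (\sum_(k < n) g (iter k sshift a) - \sum_(k < n) ln (cyl1_mass (a k))).
rewrite addrA subrK; lra.
Qed.

End gibbs.

End shift_measure.

(** * Approximation of Borel sets by sets depending on finitely many symbols *)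

Section determined_approximation.
Context {R : realType}.
Variable mu : probability Sigma R.

Definition approximable (B : set Sigma) := measurable B /\
  forall eps : R, 0 < eps -> exists (m : nat) (B' : set Sigma),
    determined m B' /\ (mu (B `+` B') < eps%:E)%E.

Lemma measurable_setY (A B : set Sigma) :
  measurable A -> measurable B -> measurable (A `+` B).
Proof. by move=> mA mB; apply: measurableU; exact: measurableD. Qed.

Lemma approximableC B : approximable B -> approximable (~` B).
Proof.
move=> [mB H]; split; first exact: measurableC.
move=> eps /H[m [B' [dB' lt]]]; exists m, (~` B'); split.
  by move=> a b ab na nb; apply: na; apply: dB' nb.
have -> : ~` B `+` ~` B' = B `+` B'; last by [].
apply/seteqP; split=> a /=; rewrite /setY /setD /=.
  by case=> -[h1 /contrapT h2]; [right|left].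
by case=> -[h1 h2]; [right|left]; split => //; exact/notK.
Qed.

Lemma approximableU A B : approximable A -> approximable B ->
  approximable (A `|` B).
Proof.
move=> [mA HA] [mB HB]; split; first exact: measurableU.
move=> eps eps0; have e2 : 0 < eps / 2 by rewrite divr_gt0.
have [m [A' [dA' ltA]]] := HA _ e2; have [n [B' [dB' ltB]]] := HB _ e2.
have dA := determined_widen (leq_maxl m n) dA'.
have dB := determined_widen (leq_maxr m n) dB'.
exists (maxn m n), (A' `|` B'); split.
  by move=> a b ab [/(dA _ _ ab)|/(dB _ _ ab)]; [left|right].
have mA' := measurable_determined dA; have mB' := measurable_determined dB.
apply: (@le_lt_trans _ _ (mu ((A `+` A') `|` (B `+` B')))).
  apply: le_measure; rewrite ?inE.
  - by apply: measurable_setY; exact: measurableU.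
  - by apply: measurableU; exact: measurable_setY.
  - move=> a; rewrite /setY /setD /=.
    have [?|?] := pselect (A a); have [?|?] := pselect (A' a);
    have [?|?] := pselect (B a); have [?|?] := pselect (B' a); tauto.
apply: (@le_lt_trans _ _ (mu (A `+` A') + mu (B `+` B'))%E).
  by apply: measureU2; exact: measurable_setY.
rewrite [in ltRHS](splitr eps) EFinD; exact: lteD.
Qed.

(** Continuity from above reduces the union to finitely many terms up to [eps / 2], and the finite
    union is approximated within the other half. *)
Lemma approximable_bigcup (F : (set Sigma)^nat) :
  (forall n, approximable (F n)) -> approximable (\bigcup_n F n).
Proof.
move=> aF; have mF n : measurable (F n) by have [] := aF n.
have mUF : measurable (\bigcup_n F n) by exact: bigcupT_measurable.
split=> // eps eps0; have e2 : 0 < eps / 2 by rewrite divr_gt0.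
pose G n := \big[setU/set0]_(i < n) F i.
have mG n : measurable (G n) by exact: bigsetU_measurable.
have aG n : approximable (G n).
  rewrite /G; elim: n => [|n IH]; last by rewrite big_ord_recr; exact: approximableU.
  rewrite big_ord0; split=> // e e0; exists 0%N, set0; split=> //.
  by rewrite setYK measure0 lte_fin.
have GE : \bigcup_n G n = \bigcup_n F n.
  apply/seteqP; split=> [a [n _ Gn]|a [n _ Fn]].
    by move: Gn; rewrite /G -bigcup_mkord => -[i _ ?]; exists i.
  by exists n.+1 => //; rewrite /G -bigcup_mkord; exists n => /=.
have [n Hn] : exists n, (mu (\bigcup_n F n `\` G n) < (eps / 2)%:E)%E.
  pose H n := \bigcup_n F n `\` G n.
  have mH n : measurable (H n) by exact: measurableD.
  have H0 : \bigcap_n H n = set0.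
    apply/seteqP; split=> // a Ha; have [] := Ha 0%N I; rewrite -GE => -[n _ Gn] _.
    by have [_] := Ha n I; exact.
  have niH : nonincreasing_seq H.
    apply/nonincreasing_seqP => i; apply/subsetPset => a [Fa Ga]; split=> // Gi.
    by apply: Ga; rewrite /G big_ord_recr; left.
  have cH : mu \o H @ \oo --> 0%E.
    rewrite -(measure0 mu) -H0; apply: nonincreasing_cvg_mu => //.
      by rewrite -ge0_fin_numE// fin_num_measure.
    by rewrite H0.
  apply: contrapT => /forallNP Hge.
  have : ((eps / 2)%:E <= limn (mu \o H))%E.
    apply: lime_ge; first by apply/cvg_ex; exists 0%E.
    by near=> n; rewrite leNgt; apply/negP; exact: Hge.
  by rewrite (cvg_lim _ cH)// lee_fin leNgt e2.
have [_ /(_ _ e2)[m [B' [dB' ltB]]]] := aG n.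
have mB' := measurable_determined dB'.
exists m, B'; split=> //.
apply: (@le_lt_trans _ _ (mu ((\bigcup_n F n `\` G n) `|` (G n `+` B')))).
  apply: le_measure; rewrite ?inE.
  - exact: measurable_setY.
  - by apply: measurableU; [exact: measurableD|exact: measurable_setY].
  - have Gs : G n `<=` \bigcup_n F n by rewrite -GE => a; exists n.
    move=> a; rewrite /setY /setD /=; move: (Gs a).
    have [?|?] := pselect ((\bigcup_n F n) a); have [?|?] := pselect (G n a);
    have [?|?] := pselect (B' a); tauto.
apply: (@le_lt_trans _ _ (mu (\bigcup_n F n `\` G n) + mu (G n `+` B'))%E).
  by apply: measureU2; [exact: measurableD|exact: measurable_setY].
by rewrite [in ltRHS](splitr eps) EFinD; exact: lteD.
Unshelve. all: by end_near. Qed.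

Lemma measurable_approximable B : measurable B -> approximable B.
Proof.
apply: (@Sigma_measurable_ind approximable); last first.
  move=> w; split=> [|eps eps0]; first exact: measurable_Scyl.
  exists (size w), (Scyl w); split; first by move=> a b; rewrite /Scyl /= => ->.
  by rewrite setYK measure0 lte_fin.
split.
- split=> // eps eps0; exists 0%N, set0; split=> //.
  by rewrite setYK measure0 lte_fin.
- by move=> A /approximableC; rewrite setTD.
- exact: approximable_bigcup.
Qed.

End determined_approximation.

(** * Entropy *)

(** This is [ln x <= x - 1] at [x = t i / q i], weighted by [q i] and summed; indices with [q i = 0]
    contribute 0 to both entropies. *)
Lemma gibbs_inequality (R : realType) (I : finType) (q t : I -> R) :
  (forall i, 0 <= q i) -> (forall i, 0 < t i) -> \sum_i t i <= \sum_i q i ->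
  \sum_i - (q i * ln (q i)) <= \sum_i - (q i * ln (t i)).
Proof.
move=> q0 t0 tq; rewrite -subr_le0 -sumrB.
apply: (@le_trans _ _ (\sum_i (t i - q i))); last by rewrite sumrB subr_le0.
apply: ler_sum => i _; have [->|qi] := eqVneq (q i) 0.
  by rewrite !mul0r; have := t0 i; lra.
have {}qi : 0 < q i by rewrite lt0r qi q0.
have -> : - (q i * ln (q i)) - - (q i * ln (t i)) = q i * ln (t i / q i).
  by rewrite ln_div ?posrE//; ring.
have tqi : -1 < t i / q i - 1 by rewrite ltrBrDl subrr divr_gt0.
have := le_ln1Dx tqi; rewrite addrC subrK => H.
rewrite -(ler_pM2l qi) in H; apply: le_trans H _.
by rewrite mulrBr mulr1 mulrC divfK// gt_eqF.
Qed.

Lemma integral_comp_fin d (X : measurableType d) (R : realType)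
    (m : probability X R) (I : finType) (v : X -> I) (F : I -> R) :
  (forall i, measurable [set x | v x = i]) -> (forall i, 0 <= F i) ->
  (\int[m]_x (F (v x))%:E = (\sum_i F i * fine (m [set x | v x = i]))%:E)%E.
Proof.
move=> mv F0; pose A i := [set x | v x = i].
have -> : (fun x => (F (v x))%:E) =
    (fun x => \sum_(i <- index_enum I) (F i)%:E * (\1_(A i) x)%:E)%E.
  apply/funext => x; rewrite (bigD1_seq (v x)) ?mem_index_enum ?index_enum_uniq//=.
  rewrite indicE mem_set// mule1 big1 ?adde0// => i ix.
  by rewrite indicE memNset ?mule0// => /esym/eqP; apply/negP.
have mF i : measurable_fun setT (fun x => (\1_(A i) x)%:E : \bar R).
  apply/measurable_EFinP; apply: measurable_indic; exact: mv.
rewrite ge0_integral_sum//; last 2 first.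
- by move=> i; apply: measurable_funeM.
- by move=> i x _; rewrite mule_ge0 ?lee_fin.
rewrite -sumEFin; apply: eq_bigr => i _.
rewrite ge0_integralZl ?lee_fin//.
rewrite integral_indic; [|by []|exact: mv].
rewrite setIT EFinM fineK//; exact: fin_num_measure.
Qed.

Lemma bigcup_fin (I : finType) (X : Type) (F : I -> set X) :
  \bigcup_i F i = \big[setU/set0]_i F i.
Proof.
rewrite -bigcup_seq; apply: eq_bigcupl; split=> i _ //=.
exact: mem_index_enum.
Qed.

Lemma measurable_neq_fin d (X : measurableType d) (I : finType) (f g : X -> I) :
  (forall i, measurable [set x | f x = i]) ->
  (forall i, measurable [set x | g x = i]) -> measurable [set x | f x <> g x].
Proof.
move=> mf mg; have -> : [set x | f x <> g x] =
    ~` \big[setU/set0]_i ([set x | f x = i] `&` [set x | g x = i]).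
  rewrite -bigcup_fin; apply/seteqP; split=> x /=.
    by move=> fg [i _ [fi gi]]; apply: fg; rewrite fi.
  by move=> H fg; apply: H; exists (f x).
by apply: measurableC; apply: bigsetU_measurable => i _; exact: measurableI.
Qed.

Lemma measurable_comp_fin d (X : measurableType d) d' (Y : measurableType d')
    (I : finType) (v : X -> I) (F : I -> Y) :
  (forall i, measurable [set x | v x = i]) ->
  measurable_fun setT (fun x => F (v x)).
Proof.
move=> mv _ A mA; rewrite setTI.
have -> : (fun x => F (v x)) @^-1` A =
    \big[setU/set0]_i (if `[< A (F i) >] then [set x | v x = i] else set0).
  rewrite -bigcup_fin; apply/seteqP; split=> x /=.
    by move=> Ax; exists (v x) => //; rewrite asboolT.
  by move=> [i _]; case: asboolP => // Ai; rewrite /= => ->.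
by apply: bigsetU_measurable => i _; case: asboolP.
Qed.

Lemma measurable_head (R : realType) (F : nat -> R) :
  measurable_fun setT (fun a : Sigma => F (a 0%N)).
Proof.
move=> _ Y mY; rewrite setTI; apply: (@measurable_determined 1) => a b [ab].
by rewrite /= /preimage /= ab.
Qed.

Lemma ln_prod_fin (R : realType) (I : finType) (F : I -> R) :
  (forall i, 0 < F i) -> ln (\prod_i F i) = \sum_i ln (F i).
Proof.
move=> F0; suff [] : ln (\prod_i F i) = \sum_i ln (F i) /\ 0 < \prod_i F i by [].
apply: (big_rec2 (fun x y => ln x = y /\ 0 < x)).
  by rewrite ln1.
by move=> i y x _ [<- x0]; rewrite lnM ?posrE// mulr_gt0.
Qed.

(** * Entropy of finite partitions when [- ln p] has a finite integral [L] *)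

Section entropy_bound.
Context {R : realType}.
Variable mu : probability Sigma R.
Hypothesis inv_mu : invariant_measure mu sshift.
Local Notation p := (cyl1_mass mu).
Variable C : R.
Hypothesis C0 : 0 <= C.
Hypothesis quasi_product : forall (a : Sigma) n,
  `|ln (fine (mu (Scyl (mkseq a n)))) - \sum_(k < n) ln (p (a k))| <= n.+1%:R * C.
Hypothesis cyl_gt0 : forall w, 0 < fine (mu (Scyl w)).
Variable L : R.
Hypothesis intL : (\int[mu]_a (- ln (p (a 0%N)))%:E = L%:E)%E.

Section partition.
Variables (k : nat) (q : Sigma -> 'I_k.+1).
Hypothesis mq : forall i, measurable [set a | q a = i].

(** Each of the [k + 1] atoms is approximated by a finitely determined set, and [q'] picks an index
    whose set contains the point, or 0 if there is none. Off the symmetric differences only the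
    index [q a] qualifies. *)
Lemma approx_coding (eps : R) : 0 < eps ->
  exists (m : nat) (q' : Sigma -> 'I_k.+1),
  (forall a b, mkseq a m = mkseq b m -> q' a = q' b) /\
  (mu [set a | q a <> q' a] < eps%:E)%E.
Proof.
(* Dividing by [k + 2] keeps the sum of [k + 1] errors strictly below [eps]. *)
move=> eps0; have e0 : 0 < eps / k.+2%:R by rewrite divr_gt0.
have /choice[f Hf] i : exists mB : nat * set Sigma, determined mB.1 mB.2 /\
    (mu ([set a | q a = i] `+` mB.2) < (eps / k.+2%:R)%:E)%E.
  have [_ /(_ _ e0)[m [B' ?]]] := measurable_approximable mu (mq i).
  by exists (m, B').
pose m := (\max_i (f i).1)%N; pose B i := (f i).2.
have dB i : determined m (B i).
  by apply: determined_widen (Hf i).1; exact: leq_bigmax.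
pose q' a := odflt ord0 [pick i | `[< B i a >]].
exists m, q'; split=> [a b ab|].
  congr odflt; apply: eq_pick => i /=; apply/asboolP/asboolP; exact: dB.
have mB i : measurable (B i) by exact: measurable_determined (dB i).
pose Y (j : nat) := [set a | q a = inord j] `+` B (inord j).
have mY j : measurable (Y j) by exact: measurable_setY.
have sub : [set a | q a <> q' a] `<=` \big[setU/set0]_(j < k.+1) Y j.
  move=> a; rewrite /= -bigcup_mkord /=; apply: contra_notP => nU.
  have nY (i : 'I_k.+1) : ~ ([set a | q a = i] `+` B i) a.
    by move=> Yi; apply: nU; exists i => /=; rewrite ?ltn_ord// /Y inord_val.
  rewrite /q'; case: pickP => [i /asboolP Bi|/(_ (q a))/asboolP nB] /=.
    by apply: contrapT => qi; apply: (nY i); right.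
  by case: (nY (q a)); left.
have mqq : measurable [set a | q a <> q' a].
  apply: measurable_neq_fin => // i; apply: (@measurable_determined m) => a b ab /= <-.
  by congr odflt; apply: eq_pick => j /=; apply/asboolP/asboolP; exact: dB.
have le1 := @content_subadditive _ _ _ mu _ Y k.+1 (fun i _ => mY i) mqq sub.
apply: (le_lt_trans le1).
apply: (@le_lt_trans _ _ (\sum_(i < k.+1) (eps / k.+2%:R)%:E)%E).
  by apply: lee_sum => i _; exact/ltW/(Hf (inord i)).2.
rewrite sumEFin lte_fin sumr_const card_ord -[ltLHS]mulr_natr -mulrA gtr_pMr//.
by rewrite mulrC ltr_pdivrMr// mul1r ltr_nat.
Qed.

Variables (m : nat) (q' : Sigma -> 'I_k.+1).
Hypothesis dq' : forall a b, mkseq a m = mkseq b m -> q' a = q' b.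

Definition itinerary (f : Sigma -> 'I_k.+1) n (a : Sigma) : {ffun 'I_n -> 'I_k.+1} :=
  [ffun i : 'I_n => f (iter i sshift a)].

Lemma measurable_itinerary f n w : (forall i, measurable [set a | f a = i]) ->
  measurable [set a | itinerary f n a = w].
Proof.
move=> mf; have -> : [set a | itinerary f n a = w] =
    \bigcap_(i < n) (if insub i is Some i' then
       iter i sshift @^-1` [set a | f a = w i'] else setT).
  apply/seteqP; split=> a /=.
    by move=> <- i /= lin; rewrite insubT /= ffunE.
  move=> H; apply/ffunP => i; rewrite ffunE.
  by have := H i (ltn_ord i); rewrite valK.
apply: bigcap_measurableType => i _; case: insub => // i'.
exact: measurable_shift_preimage.
Qed.

Lemma measurable_q' i : measurable [set a | q' a = i].
Proof. by apply: (@measurable_determined m) => a b ab /= <-; apply/esym/dq'. Qed.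

(* A memoryless channel that copies its input with probability at least 1/2. *)
Definition channel (i j : 'I_k.+1) : R :=
  (if i == j then 2^-1 else 0) + (2 * k.+1%:R)^-1.

Lemma channel_ge i j : (2 * k.+1%:R)^-1 <= channel i j.
Proof. by rewrite /channel lerDr; case: ifP. Qed.

Lemma channel_gt0 i j : 0 < channel i j.
Proof. by apply: lt_le_trans (channel_ge i j); rewrite invr_gt0 mulr_gt0. Qed.

Lemma channel_sum i : \sum_j channel i j = 1.
Proof.
rewrite /channel big_split /= (bigD1 i)//= eqxx big1 ?addr0; last first.
  by move=> j /negPf; rewrite eq_sym => ->.
rewrite sumr_const card_ord -[X in _ + X]mulr_natr invfM -mulrA mulVf ?pnatr_eq0//.
lra.
Qed.

(** The law of the output word when the [q']-itinerary is sent letter by letter through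
    [channel]. *)
Definition mixture n (v : {ffun 'I_n -> 'I_k.+1}) : R :=
  \sum_(u : {ffun 'I_n -> 'I_k.+1})
    fine (mu [set a | itinerary q' n a = u]) * \prod_i channel (u i) (v i).

Lemma itinerary_mass_sum n f : (forall i, measurable [set a | f a = i]) ->
  \sum_(u : {ffun 'I_n -> 'I_k.+1}) fine (mu [set a | itinerary f n a = u]) = 1.
Proof.
move=> mf; have := @integral_comp_fin _ _ _ mu _ (itinerary f n) (fun=> 1)
  (fun u => measurable_itinerary u mf) (fun=> ler01).
rewrite (integral_cst mu measurableT 1%E) /= probability_setT mule1 => /eqP.
rewrite eqe => /eqP E; rewrite [RHS]E.
by apply: eq_bigr => u _; rewrite mul1r.
Qed.

Lemma mixture_sum n : \sum_(v : {ffun 'I_n -> 'I_k.+1}) mixture v = 1.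
Proof.
rewrite exchange_big /= -[RHS](itinerary_mass_sum n measurable_q'); apply: eq_bigr => u _.
rewrite -mulr_sumr.
have <- : \prod_(i < n) \sum_j channel (u i) j =
    \sum_(v : {ffun 'I_n -> 'I_k.+1}) \prod_i channel (u i) (v i).
  by rewrite bigA_distr_bigA.
by rewrite big1 ?mulr1// => i _; exact: channel_sum.
Qed.

(** Only the input word of [a] is kept from the sum. The whole cylinder of length [n + m] shares it,
    since each letter reads [m] symbols from a position below [n]. *)
Lemma mixture_ge n (v : {ffun 'I_n -> 'I_k.+1}) (a : Sigma) :
  fine (mu (Scyl (mkseq a (n + m)))) *
    \prod_(i < n) channel (q' (iter i sshift a)) (v i) <= mixture v.
Proof.
have mS := measurable_Scyl.
rewrite /mixture (bigD1 (itinerary q' n a))//=.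
apply: (@le_trans _ _ (fine (mu [set b | itinerary q' n b = itinerary q' n a]) *
  \prod_i channel (itinerary q' n a i) (v i))); last first.
  rewrite lerDl; apply: sumr_ge0 => u _; apply: mulr_ge0.
    by rewrite fine_ge0.
  by apply: prodr_ge0 => i _; exact/ltW/channel_gt0.
rewrite (eq_bigr (fun i : 'I_n => channel (itinerary q' n a i) (v i))); last first.
  by move=> i _; rewrite ffunE.
apply: ler_wpM2r; first by apply: prodr_ge0 => i _; exact/ltW/channel_gt0.
have mI := measurable_itinerary (itinerary q' n a) measurable_q'.
apply: fine_le; rewrite ?fin_num_measure//.
apply: le_measure; rewrite ?inE// => b ba.
apply/ffunP => i; rewrite !ffunE; apply: dq'.
have : Scyl (mkseq a (i + m)) b.
  have /Scyl_mkseqE H := ba; apply/Scyl_mkseqE => j ji; apply: H.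
  by apply: leq_trans ji _; rewrite leq_add2r ltnW.
by move=> /Scyl_shift; rewrite /Scyl /= size_mkseq.
Qed.

Lemma mixture_gt0 n (v : {ffun 'I_n -> 'I_k.+1}) : 0 < mixture v.
Proof.
apply: lt_le_trans (mixture_ge v zeros); rewrite mulr_gt0//.
by apply: prodr_gt0 => i _; exact: channel_gt0.
Qed.

Lemma mixture_le1 n (v : {ffun 'I_n -> 'I_k.+1}) : mixture v <= 1.
Proof.
rewrite -(mixture_sum n) (bigD1 v)//= lerDl.
by apply: sumr_ge0 => u _; exact/ltW/mixture_gt0.
Qed.

(** A bound for the cost of one letter: a correct one has channel probability at least [1 / 2], a
    wrong one at least [1 / (2 (k + 1))]. *)
Definition mismatch (a : Sigma) : R :=
  ln 2 + ln (2 * k.+1%:R) * \1_[set a | q a <> q' a] a.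

Lemma ln_channel a : - ln (channel (q' a) (q a)) <= mismatch a.
Proof.
rewrite /mismatch indicE lerNl.
have k2 : 0 < 2 * k.+1%:R :> R by rewrite mulr_gt0.
have k1 : 1 <= 2 * k.+1%:R :> R.
  by rewrite -natrM ler1n.
have l2 : 0 <= ln 2 :> R by rewrite ln_ge0// ler1n.
have [qq|/eqP qq] := eqVneq (q a) (q' a).
  rewrite memNset ?mulr0 ?addr0; last by move=> /(_ qq).
  rewrite -lnV ?posrE// ler_ln ?posrE ?channel_gt0 ?invr_gt0//.
  by rewrite /channel qq eqxx lerDl invr_ge0 ltW.
rewrite mem_set// mulr1; apply: (@le_trans _ _ (- ln (2 * k.+1%:R))).
  by rewrite lerN2 lerDr.
by rewrite -lnV ?posrE// ler_ln ?posrE ?channel_gt0 ?invr_gt0// channel_ge.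
Qed.

Lemma ln_mixture n a :
  - ln (mixture (itinerary q n a)) <= (n + m).+1%:R * C +
    \sum_(i < n + m) - ln (p (iter i sshift a 0%N)) +
    \sum_(i < n) mismatch (iter i sshift a).
Proof.
have pr0 : 0 < \prod_(i < n) channel (q' (iter i sshift a)) (itinerary q n a i).
  by apply: prodr_gt0 => i _; exact: channel_gt0.
have H := mixture_ge (itinerary q n a) a.
rewrite -ler_ln ?posrE ?mulr_gt0 ?mixture_gt0// lnM ?posrE// in H.
have Hp : - ln (\prod_(i < n) channel (q' (iter i sshift a)) (itinerary q n a i))
    <= \sum_(i < n) mismatch (iter i sshift a).
  rewrite ln_prod_fin; last by move=> i; exact: channel_gt0.
  rewrite -sumrN; apply: ler_sum => i _; rewrite ffunE; exact: ln_channel.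
have := quasi_product a (n + m); move=> /ler_normlP[Hq _].
have -> : \sum_(i < n + m) - ln (p (iter i sshift a 0%N)) =
    - \sum_(i < n + m) ln (p (a i)).
  by rewrite -sumrN; apply: eq_bigr => i _; rewrite sshiftE addn0.
lra.
Qed.

Lemma join_entropy_itinerary n (Q : 'I_k.+1 -> set Sigma) :
  (forall i a, Q i a <-> q a = i) ->
  join_entropy mu sshift Q n =
  \sum_(w : {ffun 'I_n -> 'I_k.+1}) - (fine (mu [set a | itinerary q n a = w]) *
     ln (fine (mu [set a | itinerary q n a = w]))).
Proof.
move=> Qq; apply: eq_bigr => w _.
have -> // : join_atom sshift Q w = [set a | itinerary q n a = w].
apply/seteqP; split=> a /=.
  by move=> H; apply/ffunP => i; rewrite ffunE; apply/Qq.
by move=> <- i; apply/Qq; rewrite ffunE.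
Qed.

(** Gibbs' inequality against [mixture] replaces the entropy by the integral of [- ln mixture] along
    the [q]-itinerary. The pointwise bound [ln_mixture] is then integrated, shifted terms having
    equal integrals by invariance. *)
Lemma sum_entropy_bound n :
  \sum_(w : {ffun 'I_n -> 'I_k.+1}) - (fine (mu [set a | itinerary q n a = w]) *
     ln (fine (mu [set a | itinerary q n a = w]))) <=
  (n + m).+1%:R * C + ((n + m)%:R * L +
  n%:R * (ln 2 + ln (2 * k.+1%:R) * fine (mu [set a | q a <> q' a]))).
Proof.
rewrite -lee_fin.
pose P w := fine (mu [set a | itinerary q n a = w]).
have P0 w : 0 <= P w by rewrite fine_ge0.
have mI w := measurable_itinerary w mq (n := n).
apply: (@le_trans _ _ (\int[mu]_a (- ln (mixture (itinerary q n a)))%:E)%E).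
  rewrite (@integral_comp_fin _ _ _ mu _ (itinerary q n)
    (fun w => - ln (mixture w)) mI).
    rewrite lee_fin.
    rewrite [leRHS](eq_bigr (fun w => - (P w * ln (mixture w)))); last first.
      by move=> w _; rewrite mulNr mulrC.
    apply: gibbs_inequality => //; first by move=> w; exact: mixture_gt0.
    by rewrite mixture_sum (itinerary_mass_sum n mq).
  by move=> w; rewrite oppr_ge0 ln_le0// mixture_le1.
pose H (a : Sigma) := (- ln (p (a 0%N)))%:E.
pose M a := (mismatch a)%:E.
have mH : measurable_fun setT H.
  apply/measurable_EFinP; exact: (@measurable_head R (fun i => - ln (p i))).
have H0 a : (0 <= H a)%E by rewrite lee_fin oppr_ge0 ln_le0// cyl1_mass_le1.
have mqq : measurable [set a | q a <> q' a].
  by apply: measurable_neq_fin => //; exact: measurable_q'.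
have m1 : measurable_fun setT (fun a => (\1_[set a | q a <> q' a] a)%:E : \bar R).
  by apply/measurable_EFinP; exact: measurable_indic.
have l2 : 0 <= ln 2 :> R by rewrite ln_ge0// ler1n.
have lk : 0 <= ln (2 * k.+1%:R) :> R by rewrite ln_ge0// -natrM ler1n.
have MD : M = (fun a => (ln 2)%:E + (ln (2 * k.+1%:R))%:E *
    (\1_[set a | q a <> q' a] a)%:E)%E by [].
have mlm : measurable_fun setT (fun a => (ln (2 * k.+1%:R))%:E *
    (\1_[set a | q a <> q' a] a)%:E : \bar R)%E by exact: measurable_funeM.
have mM : measurable_fun setT M.
  by rewrite MD; apply: emeasurable_funD => //; exact: measurable_cst.
have M0 a : (0 <= M a)%E by rewrite MD adde_ge0 ?mule_ge0 ?lee_fin.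
have IM : (\int[mu]_a M a =
    (ln 2 + ln (2 * k.+1%:R) * fine (mu [set a | q a <> q' a]))%:E)%E.
  rewrite MD ge0_integralD//; last by move=> a _; rewrite mule_ge0 ?lee_fin.
  rewrite (integral_cst mu measurableT (ln 2)%:E) /= probability_setT mule1.
  rewrite ge0_integralZl ?lee_fin// integral_indic// setIT EFinD EFinM fineK//.
  exact: fin_num_measure.
have mit f i : measurable_fun setT f ->
    measurable_fun setT (fun a : Sigma => f (iter i sshift a) : \bar R).
  move=> mf; apply: (measurableT_comp mf).
  exact: (measurable_iter measurable_sshift).
pose c : R := (n + m).+1%:R * C.
have c0 : 0 <= c by rewrite mulr_ge0.
pose SH a := (\sum_(i < n + m) H (iter i sshift a))%E.
pose SM a := (\sum_(i < n) M (iter i sshift a))%E.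
have mSH : measurable_fun setT SH by apply: emeasurable_sum => i; exact: mit.
have mSM : measurable_fun setT SM by apply: emeasurable_sum => i; exact: mit.
have SH0 a : (0 <= SH a)%E by apply: sume_ge0.
have SM0 a : (0 <= SM a)%E by apply: sume_ge0.
apply: (@le_trans _ _ (\int[mu]_a (c%:E + (SH a + SM a)))%E).
  apply: ge0_le_integral => //.
  - by move=> a _; rewrite lee_fin oppr_ge0 ln_le0// mixture_le1.
  - apply/measurable_EFinP.
    exact: (measurable_comp_fin (fun w => - ln (mixture w)) mI).
  - by apply: emeasurable_funD; [exact: measurable_cst|exact: emeasurable_funD].
  - move=> a _; rewrite /SH /SM !sumEFin -!EFinD lee_fin addrA.
    exact: ln_mixture.
rewrite ge0_integralD//; [|by move=> a _; rewrite adde_ge0|exact: emeasurable_funD].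
rewrite ge0_integralD// (integral_cst mu measurableT c%:E) /= probability_setT mule1.
rewrite !ge0_integral_sum//; [|by move=> i; exact: mit|by move=> i; exact: mit].
rewrite (eq_bigr (fun=> L%:E)); last first.
  by move=> i _; rewrite (integral_invariant measurable_sshift inv_mu)// intL.
rewrite [X in (_ + (_ + X))%E](eq_bigr (fun=> (\int[mu]_a M a)%E)); last first.
  by move=> i _; rewrite (integral_invariant measurable_sshift inv_mu).
by rewrite IM !sumEFin !sumr_const !card_ord -!EFinD /c !mulr_natl lexx.
Qed.

End partition.
(** The slope is common to all partitions: [q'] is taken so close to [q] that mismatches cost at
    most 1 per step, and only [c] depends on the depth [m] of the approximation. *)
Lemma join_entropy_linear k (Q : 'I_k -> set Sigma) :
  finite_measurable_partition Q -> exists c, forall n,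
  join_entropy mu sshift Q n <= c + n%:R * (C + L + ln 2 + 1).
Proof.
case: k Q => [|k] Q [mQ tQ cQ].
  by have : setT zeros by []; rewrite -cQ => -[[]].
have /choice[q Hq] a : exists i, Q i a.
  by have : setT a by []; rewrite -cQ => -[i _ ?]; exists i.
have Qq i a : Q i a <-> q a = i.
  split=> [Qi|<-//]; apply: contrapT => qi.
  by apply: qi; apply: tQ => //; exists a.
have mq i : measurable [set a | q a = i].
  by rewrite (_ : [set a | q a = i] = Q i)//; apply/seteqP; split=> a /Qq.
have lk : 0 <= ln (2 * k.+1%:R) :> R by rewrite ln_ge0// -natrM ler1n.
have e0 : 0 < (ln (2 * k.+1%:R) + 1)^-1 :> R by rewrite invr_gt0 ltr_wpDl.
have [m [q' [dq' lt]]] := approx_coding mq e0.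
exists (m.+1%:R * C + m%:R * L) => n.
rewrite (join_entropy_itinerary n Qq).
apply: le_trans (sum_entropy_bound mq dq' n) _.
have bad : ln (2 * k.+1%:R) * fine (mu [set a | q a <> q' a]) <= 1.
  have mqq : measurable [set a | q a <> q' a].
    by apply: measurable_neq_fin => //; exact: measurable_q' dq'.
  have f0 : 0 <= fine (mu [set a | q a <> q' a]) by rewrite fine_ge0.
  rewrite -(fineK (fin_num_measure mu _ mqq)) lte_fin in lt.
  rewrite -[leRHS](mulVf (lt0r_neq0 (ltr_wpDl lk ltr01))) [leRHS]mulrC.
  by apply: ler_pM => //; [rewrite lerDl|exact: ltW].
have : n%:R * (ln (2 * k.+1%:R) * fine (mu [set a | q a <> q' a])) <= n%:R.
  by rewrite ler_piMr.
rewrite -addnS !natrD; lra.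
Qed.

End entropy_bound.

(** A divergent sequence has the default [point] as its [limn], hence the maximum. Otherwise, for
    large [n], the constant [c] is below [n + 1] and adds at most 1 to the slope. *)
Lemma partition_entropy_le d (X : measurableType d) (R : realType)
    (m : set X -> \bar R) (f : X -> X) k (P : 'I_k -> set X) (c D : R) :
  (forall n, join_entropy m f P n <= c + n%:R * D) ->
  (partition_entropy m f P <= maxe point (D + 1)%:E)%E.
Proof.
move=> H; rewrite /partition_entropy; set u := fun n : nat => _.
have [cu|ncu] := pselect (cvgn u); last first.
  by rewrite (dvgP ncu) le_max lexx.
rewrite le_max; apply/orP; right; apply: lime_le => //.
exists (Num.bound `|c|) => // n /= nc; rewrite lee_fin.
have n0 : (0 : R) < n.+1%:R by [].
rewrite ler_pdivrMr//; apply: le_trans (H _) _.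
have : c < n.+1%:R.
  apply: le_lt_trans (ler_norm _) _.
  apply: lt_le_trans (archi_boundP (normr_ge0 c)) _.
  by rewrite ler_nat (leq_trans nc).
lra.
Qed.

(** * Passage from the shift to the interval *)

Section emr_measure.
Context {R : realType}.
Variables (T : EMR_map R) (mu : probability Sigma R).
Hypothesis inv_mu : invariant_measure mu sshift.
Local Notation pi := (emr_pi T).

Lemma measurable_emr_pi_preimage A : measurable A -> measurable (pi @^-1` A).
Proof.
by move=> mA; rewrite -[X in measurable X]setTI; exact: measurable_emr_pi.
Qed.

Lemma emr_proj_cyl w : emr_proj T mu (emr_cyl T w) = mu (Scyl w).
Proof.
rewrite /emr_proj /pushforward.
apply: (measure_eq_off_null _ _ (last_nonzero_negligible inv_mu)).
- by apply: measurable_emr_pi_preimage; rewrite emr_cylE.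
- exact: measurable_Scyl.
- by move=> a /= /emr_cyl_pi[|[n ?]]; [left|right; exists n].
- by move=> a /(Scyl_emr_cyl T); left.
Qed.

Lemma emr_pE n : emr_p T mu n = cyl1_mass mu n.
Proof.
rewrite /emr_p /cyl1_mass -emr_proj_cyl; congr (fine (emr_proj T mu _)).
apply/seteqP; split=> x /= => [xn|[]//]; split=> //.
exact: emr_branch_in.
Qed.

Lemma measurable_iter_emr_T_pi n :
  measurable_fun setT (fun a => iter n (emr_T T) (pi a)).
Proof.
(* [emr_T] is given as measurable on [[0, 1]], so the orbits have to be kept there. *)
have in01 k a : `[0, 1]%classic (iter k (emr_T T) (pi a)).
  elim: k => [|k IH]; last exact: (@emr_self _ T _ IH).
  exact: (emr_itv01 (emr_pi_in T a)).
elim: n => [|n IH]; first exact: measurable_emr_pi.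
have sub : (fun a => iter n (emr_T T) (pi a)) @` setT `<=` `[0, 1]%classic.
  by move=> _ [a _ <-]; exact: in01.
exact: (measurable_comp (measurable_itv _) sub (@emr_meas _ T) IH).
Qed.

(** Off the eventually zero sequences [pi] conjugates the shift to [T], so corresponding atoms have
    the same mass. *)
Lemma join_entropy_emr_proj k (P : 'I_k -> set R) n :
  (forall i, measurable (P i)) -> mu.-negligible eventually_zeros ->
  join_entropy (emr_proj T mu) (emr_T T) P n =
  join_entropy mu sshift (fun i => pi @^-1` P i) n.
Proof.
move=> mP N0; apply: eq_bigr => w _.
suff -> : emr_proj T mu (join_atom (emr_T T) P w) =
  mu (join_atom sshift (fun i => pi @^-1` P i) w) by [].
rewrite /emr_proj /pushforward.
have E a : ~ eventually_zeros a -> forall i,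
    iter i (emr_T T) (pi a) = pi (iter i sshift a).
  by move=> na i; apply: iter_emr_T_pi => j aj; apply: na; exists j.
have joinE (X : Type) (f : Sigma -> X) (F : nat -> Sigma -> X) (S : 'I_k -> set X) :
    [set a | forall i : 'I_n, S (w i) (F i a)] =
    \bigcap_(j < n) (if insub j is Some i then F j @^-1` S (w i) else setT).
  apply/seteqP; split=> a /= H.
    by move=> j /= jn; rewrite insubT /=; exact: (H (Ordinal jn)).
  by move=> i; have := H i (ltn_ord i); rewrite valK.
apply: (measure_eq_off_null _ _ N0).
- rewrite (_ : _ @^-1` _ =
    [set a | forall i : 'I_n, P (w i) (iter i (emr_T T) (pi a))])//.
  rewrite (joinE _ pi (fun i a => iter i (emr_T T) (pi a))).
  apply: bigcap_measurableType => j _; case: insub => // i.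
  by rewrite -[X in measurable X]setTI; exact: measurable_iter_emr_T_pi.
- rewrite /join_atom (joinE _ id (fun i a => iter i sshift a) (fun i => pi @^-1` P i)).
  apply: bigcap_measurableType => j _; case: insub => // i.
  by apply: measurable_shift_preimage; exact: measurable_emr_pi_preimage.
- move=> a /= Ha; have [?|na] := pselect (eventually_zeros a); first by right.
  by left=> i; have := Ha i; rewrite (E a na).
- move=> a /= Ha; have [?|na] := pselect (eventually_zeros a); first by right.
  by left=> i; rewrite (E a na); exact: Ha.
Qed.

Variables (g : Sigma -> R) (gibbs_mu : gibbs_measure mu g 0).
Hypothesis erg_mu : ergodic mu sshift.

Lemma Scyl1_neq0 : mu (Scyl [:: 1%N]) != 0%E.
Proof.
by apply/eqP => E; have := Scyl_gt0 gibbs_mu [:: 1%N]; rewrite E ltxx.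
Qed.

(** A finite integral would bound the entropies of all finite partitions by one finite number,
    through the common slope of [join_entropy_linear]. *)
Lemma infinite_entropy_mass :
  metric_entropy (emr_proj T mu) (emr_T T) = +oo%E ->
  (\int[mu]_a (- ln (cyl1_mass mu (a 0%N)))%:E = +oo)%E.
Proof.
move=> hoo.
set I := (\int[mu]_a _)%E; have I0 : (0 <= I)%E.
  by apply: integral_ge0 => a _; rewrite lee_fin oppr_ge0 ln_le0// cyl1_mass_le1.
case IE : I I0 => [L| |] // _; exfalso.
have [C C0 HC] := gibbs_quasi_product gibbs_mu.
have N0 := eventually_zeros_negligible inv_mu erg_mu Scyl1_neq0.
suff : (metric_entropy (emr_proj T mu) (emr_T T) <=
    maxe point (C + L + ln 2 + 1 + 1)%:E)%E.
  by rewrite hoo leye_eq; apply/negP; rewrite /Order.max; case: ifP.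
apply: ge_ereal_sup => _ [k [P [[mP tP cP] ->]]].
have [c Hc] : exists c, forall n, join_entropy mu sshift (fun i => pi @^-1` P i) n
    <= c + n%:R * (C + L + ln 2 + 1).
  apply: (join_entropy_linear inv_mu C0 HC (Scyl_gt0 gibbs_mu) IE).
  split.
  - by move=> i; exact: measurable_emr_pi_preimage.
  - by move=> i j _ _ [a [Pi Pj]]; apply: tP => //; exists (pi a).
  - by rewrite -preimage_bigcup cP preimage_setT.
apply: (@partition_entropy_le _ _ _ _ _ _ _ c) => n.
by rewrite join_entropy_emr_proj.
Qed.

End emr_measure.

(** * Local dimension *)

Section local_dimension.
Context {R : realType}.
Variable T : EMR_map R.
Local Notation r := (emr_r T).

Lemma ln_emr_r_lt0 n : ln (r n) < 0.
Proof. by rewrite ln_lt0// emr_r_gt0 emr_r_lt1. Qed.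

(** Each further symbol costs one use of [emr_distortion], an error of at most [ln D]. *)
Lemma ln_len_cyl : exists2 D : R, 0 <= D & forall (a : Sigma) n,
  `|ln (len (emr_cyl T (mkseq a n))) - \sum_(k < n) ln (r (a k))| <= n%:R * D.
Proof.
have [D D1 H] := emr_distortion T; exists (ln D); first exact: ln_ge0.
have D0 : 0 < D by exact: lt_le_trans D1.
move=> a n; elim: n a => [|n IH] a.
  by rewrite big_ord0 mul0r /= len_itv// !subr0 ln1 normr0.
rewrite big_ord_recl mkseq_sshift; set w := mkseq _ n.
have lo0 : 0 <= emr_lo T w by have := emr_lo_in T w; rewrite in_itv/= => /andP[].
have hi1 : emr_hi T w <= 1 by have := emr_hi_in T w; rewrite in_itv/= => /andP[].
have [H1 H2] := H (a 0%N) _ _ lo0 (emr_lo_lt_hi T w) hi1.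
rewrite -!len_cyl -[X in D * X](len_cyl T (a 0%N :: w)) in H1.
rewrite -!len_cyl -[X in X <= _](len_cyl T (a 0%N :: w)) in H2.
have r0 := emr_r_gt0 T (a 0%N); have lw := len_cyl_gt0 T w.
have la := len_cyl_gt0 T (a 0%N :: w).
rewrite -ler_ln ?posrE ?mulr_gt0// !lnM ?posrE// in H1.
rewrite -ler_ln ?posrE ?mulr_gt0// !lnM ?posrE ?mulr_gt0// in H2.
have := IH (sshift a); rewrite -/w /= => /ler_normlP[E1 E2].
have -> : \sum_(i < n) ln (r (a (lift ord0 i))) =
  \sum_(k < n) ln (r (sshift a k)) by [].
rewrite -natr1 mulrDl mul1r; apply/ler_normlP; split; lra.
Qed.

Variables (p : nat -> R) (s : R).
Hypothesis decay : (fun n : nat => ln (p n) / ln (r n)) @ \oo --> s.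

(** Beyond some [N] the ratio is within [eps] of [s]; [M] is the sum of the finitely many earlier
    deviations. *)
Lemma decay_ratio_linear (eps : R) : 0 < eps -> exists2 M : R, 0 <= M &
  forall n, `|ln (p n) - s * ln (r n)| <= eps * - ln (r n) + M.
Proof.
move=> eps0; have /cvgrPdist_lt/(_ eps eps0)[N _ HN] := decay.
exists (\sum_(i < N) `|ln (p i) - s * ln (r i)|); first exact: sumr_ge0.
move=> n; have rn := ln_emr_r_lt0 n.
have [Nn|nN] := leqP N n; last first.
  rewrite (bigD1 (Ordinal nN))//= addrCA lerDl addr_ge0 ?sumr_ge0//.
  by apply: mulr_ge0; [exact: ltW|rewrite oppr_ge0 ltW].
rewrite ler_wpDr ?sumr_ge0//.
have -> : ln (p n) - s * ln (r n) = (ln (p n) / ln (r n) - s) * ln (r n).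
  by rewrite mulrBl divfK// lt_eqF.
rewrite normrM (ltr0_norm rn); apply: ler_wpM2r; first by rewrite oppr_ge0 ltW.
by rewrite distrC; apply/ltW/HN.
Qed.

Variables (m : seq nat -> R) (C : R).
Hypothesis C0 : 0 <= C.

(** The errors linear in [n] vanish in the quotient, because the growth hypothesis makes minus the
    logarithm of the length eventually exceed any multiple of [n]. *)
Lemma decay_ratio_cvg (a : Sigma) :
  (forall n, `|ln (m (mkseq a n)) - \sum_(k < n) ln (p (a k))| <= n.+1%:R * C) ->
  (forall c : nat, exists j : nat, forall n,
     n%:R * c%:R <= \sum_(k < n) - ln (r (a k)) + j%:R) ->
  (fun n => ln (m (mkseq a n)) / ln (len (emr_cyl T (mkseq a n)))) @ \oo --> s.
Proof.
move=> Hm Hc; apply/cvgrPdist_le => e e0; pose eps : R := e / 2.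
have eps0 : 0 < eps by rewrite divr_gt0.
have [D D0 HD] := ln_len_cyl; have [M M0 HM] := decay_ratio_linear eps0.
(* [K] collects the linear errors: [2 * C] from the masses, since [n + 1 <= 2 n], [M] from the decay
   ratio, and two multiples of [D] from replacing [S] by [- la]. *)
pose K := 2 * C + M + `|s| * D + eps * D.
have K0 : 0 <= K by rewrite !addr_ge0 ?mulr_ge0// ltW.
have Ke0 : 0 <= K / eps by apply: divr_ge0 => //; exact: ltW.
(* Chosen so that [n * K] ends up below [eps * - la]; with the other [eps * - la], coming from the
   decay ratio, this adds up to the tolerance [e]. *)
pose c := Num.bound (D + K / eps + 1).
have [j Hj] := Hc c; exists j.+1 => // n /= jn.
set la := ln (len _); set S := \sum_(k < n) - ln (r (a k)) in Hj *.
have n1 : (1 : R) <= n%:R by rewrite ler1n (leq_trans _ jn).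
have cge : D + K / eps + 1 < c%:R.
  by apply: archi_boundP; lra.
have SE : \sum_(k < n) ln (r (a k)) = - S by rewrite /S sumrN opprK.
have H1 := HD a n; rewrite -/la SE opprK in H1.
have /ler_normlP[H1a H1b] := H1.
have lan : n%:R * (K / eps) < - la.
  have := Hj n; rewrite -/S => Hjn.
  have : n%:R * (D + K / eps + 1) <= n%:R * c%:R by apply: ler_wpM2l => //; exact: ltW.
  have : j%:R < n%:R :> R by rewrite ltr_nat.
  lra.
have la0 : la < 0.
  by rewrite -oppr_gt0; apply: le_lt_trans lan; rewrite mulr_ge0.
have nK : n%:R * K < eps * - la.
  by rewrite -ltr_pdivrMl// mulrC -mulrA.
have H2 : `|\sum_(k < n) ln (p (a k)) + s * S| <= eps * S + n%:R * M.
  rewrite /S mulr_sumr -big_split /= mulr_sumr.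
  apply: le_trans (ler_norm_sum _ _ _) _.
  rewrite -[X in X%:R * M]card_ord mulr_natl -sumr_const -big_split /=.
  by apply: ler_sum => k _; rewrite mulrN; exact: HM.
have H3 := Hm n.
have key : `|ln (m (mkseq a n)) - s * la| <= eps * - la + n%:R * K.
  have E : ln (m (mkseq a n)) - s * la =
     (ln (m (mkseq a n)) - \sum_(k < n) ln (p (a k))) +
     ((\sum_(k < n) ln (p (a k)) + s * S) - s * (la + S)) by ring.
  rewrite E; apply: le_trans (ler_normD _ _) _.
  have B1 := ler_normB (\sum_(k < n) ln (p (a k)) + s * S) (s * (la + S)).
  have B2 : `|s * (la + S)| <= `|s| * (n%:R * D) by rewrite normrM ler_wpM2l.
  have B3 : eps * S <= eps * (n%:R * D - la) by rewrite ler_wpM2l ?(ltW eps0)//; lra.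
  have B4 : n.+1%:R * C <= n%:R * (2 * C).
    by rewrite mulrA ler_wpM2r// -natr1; lra.
  rewrite /K; lra.
have -> : s - ln (m (mkseq a n)) / la = - (ln (m (mkseq a n)) - s * la) / la.
  by rewrite opprB mulrBl mulfK// lt_eqF.
rewrite normrM normfV normrN ler_pdivrMr ?normr_gt0 ?lt_eqF// (ltr0_norm la0).
apply: (le_trans key); rewrite (_ : e = eps + eps) ?mulrDl ?lerD2l ?ltW//.
by rewrite /eps -splitr.
Qed.

End local_dimension.

Theorem theorem2p13 (R : realType) (T : EMR_map R)
    (mu : probability Sigma R) (phi : Sigma -> R)
    (phi_gt0 : forall a, 0 < phi a)
    (mu_gibbs : gibbs_measure mu (fun a => ln (phi a)) 0)
    (mu_ergodic : ergodic mu sshift)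
    (mu_entropy : metric_entropy (emr_proj T mu) (emr_T T) = +oo%E)
    (phi_var1 : (var1 (fun a => ln (phi a)) < +oo)%E)
    (K K' : R) (K_gt0 : 0 < K) (K_le : K <= K')
    (phi_ratio : forall n : nat,
      K <= phi (fun _ => n.+1) / phi (fun _ => n) <= K')
    (s : R)
    (decay_ratio : (fun n : nat => ln (emr_p T mu n) / ln (emr_r T n)) @ \oo
      --> s) :
  {ae emr_proj T mu, forall x,
    delta_lower T mu x = delta_upper T mu x /\
    delta_upper T mu x = s%:E}.
Proof.
have inv_mu : invariant_measure mu sshift by case: mu_gibbs.
have pE : emr_p T mu = cyl1_mass mu by apply/funext => n; exact: emr_pE.
rewrite pE in decay_ratio.
have poo := infinite_entropy_mass inv_mu mu_gibbs mu_ergodic mu_entropy.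
pose g (a : Sigma) := - ln (emr_r T (a 0%N)).
have g0 a : 0 <= g a by rewrite oppr_ge0 ltW// ln_emr_r_lt0.
have mg : measurable_fun setT g.
  exact: (@measurable_head R (fun i => - ln (emr_r T i))).
(* With tolerance 1 in the decay ratio, [- ln p_n] is at most [|s| + 1] times [- ln r_n] plus a
   constant, so the infinite integral passes from the masses to the lengths. *)
have goo : (\int[mu]_a (g a)%:E = +oo)%E.
  have [M M0 HM] := decay_ratio_linear decay_ratio ltr01.
  apply/eqP; rewrite -leye_eq leNgt; apply/negP => gfin.
  have mge : measurable_fun setT (EFin \o g) by exact/measurable_EFinP.
  have s1 : 0 <= `|s| + 1 by rewrite addr_ge0.
  have mZ : measurable_fun setT (fun a => (`|s| + 1)%:E * (g a)%:E)%E.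
    exact: measurable_funeM.
  have Z0 a : setT a -> (0 <= (`|s| + 1)%:E * (g a)%:E)%E.
    by move=> _; apply: mule_ge0; rewrite lee_fin.
  suff : (\int[mu]_a (- ln (cyl1_mass mu (a 0%N)))%:E <=
      (`|s| + 1)%:E * \int[mu]_a (g a)%:E + M%:E)%E.
    rewrite poo leye_eq => /eqP E; suff : (+oo < +oo :> \bar R)%E by rewrite ltxx.
    rewrite -[X in (X < _)%E]E lte_add_pinfty ?ltry// lte_mul_pinfty ?lee_fin//.
  rewrite -ge0_integralZl ?lee_fin//; last by move=> a _; rewrite lee_fin.
  rewrite -[X in (_ <= _ + X)%E]mule1 -(@probability_setT _ _ _ mu).
  rewrite -(integral_cst mu measurableT M%:E) -ge0_integralD//.
  apply: ge0_le_integral => //.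
  - by move=> a _; rewrite lee_fin oppr_ge0 ln_le0// cyl1_mass_le1.
  - apply/measurable_EFinP.
    exact: (@measurable_head R (fun i => - ln (cyl1_mass mu i))).
  - by apply: emeasurable_funD => //; exact: measurable_cst.
  move=> a _; rewrite /= -EFinM -EFinD lee_fin.
  have /ler_normlP[H _] := HM (a 0%N).
  have : - s * g a <= `|s| * g a by rewrite ler_wpM2r// -normrN ler_norm.
  have : s * g a <= `|s| * g a by rewrite ler_wpM2r// ler_norm.
  move: H; rewrite -/(g a) /g; lra.
pose B := \bigcup_(c : nat) slow_growth sshift c%:R g.
have mS c : measurable (slow_growth sshift c g).
  exact: (measurable_slow_growth measurable_sshift).
have mB : measurable B by apply: bigcupT_measurable => c; exact: mS.
have B0 : mu B = 0%E.
  apply: measure_negligible => //; apply: negligible_bigcup => c.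
  apply/negligibleP; first exact: mS.
  exact: (slow_growth_null measurable_sshift inv_mu mu_ergodic).
have [C C0 HC] := gibbs_quasi_product mu_gibbs.
(* The exceptional set consists of the points without coding and the image of [B]; by injectivity
   its preimage is exactly [B]. *)
exists (~` (emr_pi T @` (~` B))); split.
- by apply: measurableC; apply: measurable_image_emr_pi; exact: measurableC.
- rewrite /emr_proj /pushforward (_ : _ @^-1` _ = B)//.
  apply/seteqP; split=> a /=.
    by move=> H; apply: contrapT => Ba; apply: H; exists a.
  by move=> Ba [b nBb /emr_pi_inj ba]; apply: nBb; rewrite ba.
move=> x /= nx [a nBa ax]; apply: nx; rewrite -ax.
have cvg_delta : delta_seq T mu (emr_pi T a) @ \oo --> s%:E.
  rewrite (_ : delta_seq T mu (emr_pi T a) = EFin \o (fun n =>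
    ln (fine (mu (Scyl (mkseq a n)))) / ln (len (emr_cyl T (mkseq a n))))).
    apply: cvg_EFin; first by near=> n.
    apply: (@decay_ratio_cvg R T (cyl1_mass mu) s decay_ratio
      (fun w => fine (mu (Scyl w))) C C0 a (HC a)) => c.
    (* If no [j] worked for the slope [c], then [a] would lie in [slow_growth] for that slope, hence
       in [B]. *)
    apply: contrapT => /forallNP nj; apply: nBa; exists c => // j.
    have /existsNP[n Hn] := nj j; exists n.
    rewrite (eq_bigr (fun k : 'I_n => - ln (emr_r T (a k)))); last first.
      by move=> k _; rewrite /g sshiftE addn0.
    by rewrite ltNge; exact/negP.
  apply/funext => n; rewrite /delta_seq /emr_In emr_coding_pi.
  by rewrite emr_proj_cyl.
have [E1 E2] := cvg_limn_einf_sup cvg_delta.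
by rewrite /delta_lower /delta_upper E1 E2.
Unshelve. all: by end_near. Qed.
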